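(* Every finite irreducible nontrivial conformal module over the Lie conformal algebra of $\mathcal{W}(2,2)$-type is isomorphic to a module of the form $$M_{\Delta,\alpha}=\mathbb{C}[\partial]v,\quad L_\lambda v=(\partial+\alpha+\Delta\lambda)v,\quad H_\lambda v=0,$$ free of rank one over $\mathbb{C}[\partial]$ with generator $v$, for some $\Delta\in\mathbb{C}\setminus\{0\}$ and $\alpha\in\mathbb{C}$.
   Context: A Lie conformal algebra is a $\mathbb{C}[\partial]$-module $\mathcal{A}$ with a $\mathbb{C}$-bilinear $\lambda$-bracket $\mathcal{A}\otimes\mathcal{A}\to\mathbb{C}[\lambda]\otimes\mathcal{A}$, $a\otimes b\mapsto[a_\lambda b]$, satisfying $[\partial a_\lambda b]=-\lambda[a_\lambda b]$, $[a_\lambda\partial b]=(\partial+\lambda)[a_\lambda b]$, $[a_\lambda b]=-[b_{-\lambda-\partial}a]$, and $[a_\lambda[b_\mu c]]=[[a_\lambda b]_{\lambda+\mu}c]+[b_\mu[a_\lambda c]]$. A conformal module over $\mathcal{A}$ is a $\mathbb{C}[\partial]$-module $V$ with a $\mathbb{C}$-bilinear map $\mathcal{A}\otimes V\to V[\lambda]$, $a\otimes v\mapsto a_\lambda v$, such that $a_\lambda(b_\mu v)-b_\mu(a_\lambda v)=[a_\lambda b]_{\lambda+\mu}v$, $(\partial a)_\lambda v=-\lambda a_\lambda v$, $a_\lambda(\partial v)=(\partial+\lambda)a_\lambda v$. It is finite if finitely generated over $\mathbb{C}[\partial]$; irreducible if it is nonzero and its only submodules are $0$ and itself; trivial if $a_\lambda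 v=0$ for all $a\in\mathcal{A}$, $v\in V$, and nontrivial otherwise. The Lie conformal algebra of $\mathcal{W}(2,2)$-type is the Lie conformal algebra that is free over $\mathbb{C}[\partial]$ with basis $L,H$ and brackets $[L_\lambda L]=(\partial+2\lambda)L$, $[L_\lambda H]=(\partial+2\lambda)H$, $[H_\lambda H]=0$. *)

(* Defs.v *)
From HB Require Import structures.
From mathcomp Require Import all_boot all_order all_algebra finmap ring.
From mathcomp Require Import reals complex.

Set Implicit Arguments.
Unset Strict Implicit.
Unset Printing Implicit Defensive.

Import GRing.Theory.
Local Open Scope ring_scope.

(** Polynomials with coefficients in an additive group: [vpoly V] is V[λ], and
    [u n] is the coefficient of λ^n in [u : vpoly V].                        *)

Record vpoly (V : zmodType) : predArgType :=
  Vpoly { vpoly_val : {fsfun nat -> V with 0} }.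

HB.instance Definition _ V := [isNew for @vpoly_val V].
HB.instance Definition _ V := [Choice of vpoly V by <:].

Definition vcoef (V : zmodType) (u : vpoly V) (n : nat) : V := vpoly_val u n.
Coercion vcoef : vpoly >-> Funclass.

(** A bound: [u n = 0] for [n >= vsize u]. *)
Definition vsize (V : zmodType) (u : vpoly V) : nat :=
  (\max_(i <- finsupp (vpoly_val u)) i).+1.

(** E 0 + E 1 λ + ... + E N.-1 λ^N.-1 *)
HB.lock Definition mkvpoly (V : zmodType) (N : nat) (E : nat -> V) : vpoly V :=
  Vpoly [fsfun n in [fset i in iota 0 N]%fset => E n].

HB.lock Definition vconst (V : zmodType) (v : V) : vpoly V :=
  mkvpoly 1 (fun=> v).

HB.lock Definition vadd (V : zmodType) (u v : vpoly V) : vpoly V :=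
  mkvpoly (maxn (vsize u) (vsize v)) (fun n => u n + v n).
HB.lock Definition vopp (V : zmodType) (u : vpoly V) : vpoly V :=
  mkvpoly (vsize u) (fun n => - u n).
HB.lock Definition vzero (V : zmodType) : vpoly V := mkvpoly 0 (fun=> 0).

Section VpolyZmod.
Variable V : zmodType.
Implicit Types u v w : vpoly V.

Lemma vpolyP u v : (forall n, u n = v n) <-> u = v.
Proof.
split=> [e|-> //]; case: u v e => [u] [v] e; congr Vpoly.
exact/fsfunP.
Qed.

Lemma mkvpolyE N (E : nat -> V) n :
  mkvpoly N E n = if (n < N)%N then E n else 0.
Proof. by rewrite mkvpoly.unlock /vcoef /= fsfunE !inE mem_iota. Qed.

Lemma vsizeP u n : (vsize u <= n)%N -> u n = 0.
Proof.
move=> h; apply: fsfun_dflt; apply/negP => hn.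
by move: h; rewrite leqNgt ltnS (@leq_bigmax_seq _ _ xpredT (fun i => i)).
Qed.

Lemma vconstE (v : V) n : vconst v n = if n is 0 then v else 0.
Proof. by rewrite vconst.unlock mkvpolyE; case: n. Qed.

Lemma vaddE u v n : vadd u v n = u n + v n.
Proof.
rewrite vadd.unlock mkvpolyE; case: leqP => //; rewrite geq_max => /andP[hu hv].
by rewrite !vsizeP ?addr0.
Qed.

Lemma voppE u n : vopp u n = - u n.
Proof. by rewrite vopp.unlock mkvpolyE; case: leqP => // h; rewrite vsizeP ?oppr0. Qed.

Lemma vzeroE n : vzero V n = 0. Proof. by rewrite vzero.unlock mkvpolyE. Qed.

Fact vaddA : associative (@vadd V).
Proof. by move=> u v w; apply/vpolyP=> n; rewrite !vaddE addrA. Qed.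
Fact vaddC : commutative (@vadd V).
Proof. by move=> u v; apply/vpolyP=> n; rewrite !vaddE addrC. Qed.
Fact vadd0 : left_id (vzero V) (@vadd V).
Proof. by move=> u; apply/vpolyP=> n; rewrite vaddE vzeroE add0r. Qed.
Fact vaddN : left_inverse (vzero V) (@vopp V) (@vadd V).
Proof. by move=> u; apply/vpolyP=> n; rewrite vaddE voppE vzeroE addNr. Qed.

HB.instance Definition _ :=
  GRing.isZmodule.Build (vpoly V) vaddA vaddC vadd0 vaddN.

Lemma vcoefD u v n : (u + v) n = u n + v n. Proof. exact: vaddE. Qed.
Lemma vcoefN u n : (- u) n = - u n. Proof. exact: voppE. Qed.
Lemma vcoef0 n : (0 : vpoly V) n = 0. Proof. exact: vzeroE. Qed.

Lemma vconst0 : vconst (0 : V) = 0.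
Proof. by apply/vpolyP=> -[|n]; rewrite vconstE vcoef0. Qed.
Lemma vconstD : {morph @vconst V : x y / x + y}.
Proof.
by move=> x y; apply/vpolyP=> -[|n]; rewrite vcoefD !vconstE ?addr0.
Qed.

End VpolyZmod.

(** If V is an R-module then V[λ] is an R[λ]-module. *)

HB.lock Definition vscale (R : nzRingType) (V : lmodType R) (p : {poly R})
    (u : vpoly V) : vpoly V :=
  mkvpoly (size p + vsize u) (fun n => \sum_(i < n.+1) p`_i *: u (n - i)%N).

Section VpolyLmod.
Variables (R : nzRingType) (V : lmodType R).
Implicit Types (p q : {poly R}) (u v : vpoly V).

Lemma vscaleE p u n : vscale p u n = \sum_(i < n.+1) p`_i *: u (n - i)%N.
Proof.
rewrite vscale.unlock mkvpolyE; case: leqP => // h; rewrite big1 // => i _.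
case: (ltnP i (size p)) => hi; last by rewrite nth_default ?scale0r.
rewrite vsizeP ?scaler0 // leq_subRL; last by rewrite -ltnS.
by apply: leq_trans h; rewrite leq_add2r ltnW.
Qed.

Fact vscaleA p q u : vscale p (vscale q u) = vscale (p * q) u.
Proof.
apply/vpolyP=> n; rewrite !vscaleE.
pose F k j := (p`_k * q`_j) *: u (n - k - j)%N.
transitivity (\sum_(k < n.+1) \sum_(j < n.+1 | (k + j <= n)%N) F k j).
  apply: eq_bigr => k _; rewrite vscaleE scaler_sumr.
  rewrite (big_ord_widen_cond n.+1 xpredT (fun j => p`_k *: (q`_j *: u (n - k - j)%N))).
    by apply: eq_big => [j|j _]; [rewrite /= ltnS leq_subRL -1?ltnS |rewrite scalerA].
  by rewrite ltnS leq_subr.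
transitivity (\sum_(i < n.+1) \sum_(k < n.+1 | (k <= i)%N) F k (i - k)%N); last first.
  apply: eq_bigr => i _; rewrite coefM scaler_suml.
  rewrite (big_ord_widen_cond n.+1 xpredT (fun k => (p`_k * q`_(i - k)) *: u (n - i)%N)) //.
  apply: eq_big => [k|k hk]; first by rewrite /= ltnS.
  by rewrite /F -subnDA subnKC.
rewrite [RHS](exchange_big_dep xpredT) //=; apply: eq_bigr => k _.
rewrite -(big_mkord (fun j => k + j <= n)%N (F k)).
rewrite -(big_mkord (fun i => k <= i)%N (fun i => F k (i - k)%N)).
have hk : (k <= n.+1)%N by rewrite ltnW.
rewrite [RHS](@big_cat_nat _ _ _ k) //= [X in _ = X + _]big1_seq ?add0r; last first.
  by move=> i; rewrite mem_index_iota => /andP[h1 /andP[_ h2]]; rewrite leqNgt h2 in h1.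
rewrite (_ : \sum_(k <= i < n.+1 | (k <= i)%N) F k (i - k)%N =
  \sum_(0 + k <= i < n.+1 | (k <= i)%N) F k (i - k)%N) // [RHS]big_addn.
rewrite (@big_cat_nat _ _ _ (n.+1 - k)%N) //= ?leq_subr //.
rewrite [X in _ + X]big1_seq ?addr0; last first.
  move=> j; rewrite mem_index_iota => /andP[h1 /andP[h2 _]].
  by move: h2; rewrite leq_subLR ltnNge h1.
rewrite [LHS]big_nat_cond [RHS]big_nat_cond; apply: eq_big => [j|j _].
  rewrite leq_addl andbT /= andbC; case: ltnP; rewrite ?andbF //= => h.
  by rewrite andbT; move: h; rewrite ltn_subRL ltnS => ->.
by rewrite addnK.
Qed.

Fact vscale1 : left_id 1 (@vscale R V).
Proof.
move=> u; apply/vpolyP=> n; rewrite vscaleE big_ord_recl /= coef1 scale1r subn0.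
by rewrite big1 ?addr0 // => i _; rewrite coef1 scale0r.
Qed.

Fact vscaleDr : right_distributive (@vscale R V) +%R.
Proof.
move=> p u v; apply/vpolyP=> n; rewrite vcoefD !vscaleE -big_split /=.
by apply: eq_bigr => i _; rewrite vcoefD scalerDr.
Qed.

Fact vscaleDl u : {morph (@vscale R V)^~ u : p q / p + q}.
Proof.
move=> p q; apply/vpolyP=> n; rewrite vcoefD !vscaleE -big_split /=.
by apply: eq_bigr => i _; rewrite coefD scalerDl.
Qed.

HB.instance Definition _ :=
  GRing.Zmodule_isLmodule.Build {poly R} (vpoly V)
    vscaleA vscale1 vscaleDr vscaleDl.

Lemma vcoefZ p u n : (p *: u) n = \sum_(i < n.+1) p`_i *: u (n - i)%N.
Proof. exact: vscaleE. Qed.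

Lemma vconstZ (c : R) (v : V) : vconst (c *: v) = c%:P *: vconst v.
Proof.
apply/vpolyP=> n; rewrite vcoefZ big_ord_recl /= coefC /= subn0 big1 ?addr0.
  by rewrite !vconstE; case: n => // n; rewrite scaler0.
by move=> i _; rewrite coefC /= scale0r.
Qed.

End VpolyLmod.

(** The substitution of x for λ: given [iota : V -> W], the element
    sum_n x^n iota(u_n) of the S-module W.                                   *)
HB.lock Definition vsubst (V : zmodType) (S : nzRingType) (W : lmodType S)
    (iota : V -> W) (x : S) (u : vpoly V) : W :=
  \sum_(n < vsize u) x ^+ n *: iota (u n).

(** Substitution for λ, in u : V[λ], of an element x of C[∂][λ][μ]; the result
    lies in V[λ][μ]. *)
Definition vev (R : nzRingType) (V : lmodType R) (x : {poly {poly R}})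
    (u : vpoly V) : vpoly (vpoly V) :=
  vsubst (fun v => vconst (vconst v)) x u.

(** The base field K stands for C.  C[∂]-modules are [lmodType {poly K}], with ∂ acting as ['X].  Hence
    - on V[λ] : ∂ is ['X%:P] and λ is ['X], in [{poly {poly K}}];
    - on V[λ][μ] : ∂ is ['X%:P%:P], λ is ['X%:P] and μ is ['X], in
      [{poly {poly {poly K}}}];
    - a scalar c of K is [c%:P] on V and [c%:P%:P] on V[λ].                  *)

Definition bilinear_into (K : fieldType) (A V W : lmodType {poly K})
    (f : A -> V -> vpoly W) : Prop :=
  (forall (c : K) a a' v,
     f (c%:P *: a + a') v = c%:P%:P *: f a v + f a' v) /\
  (forall (c : K) a v v',
     f a (c%:P *: v + v') = c%:P%:P *: f a v + f a v').

(** In the Jacobi identities, if [b_μ c] = sum_n μ^n c_n then [a_λ[b_μ c]] is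
    sum_n μ^n [a_λ c_n]; if [a_λ b] = sum_n λ^n w_n then [[a_λ b]_{λ+μ} c] is
    sum_n λ^n [w_n_{λ+μ} c].                                                 *)

Record lieConformal (K : fieldType) := LieConformal {
  lc_sort :> lmodType {poly K};
  lc_br : lc_sort -> lc_sort -> vpoly lc_sort;
  lc_bilinear : bilinear_into lc_br;
  lc_dl : forall a b : lc_sort, lc_br ('X *: a) b = (- 'X) *: lc_br a b;
  lc_dr : forall a b : lc_sort, lc_br a ('X *: b) = ('X%:P + 'X) *: lc_br a b;
  lc_skew : forall a b : lc_sort,
    lc_br a b = - vsubst (@vconst lc_sort) (- 'X - 'X%:P) (lc_br b a);
  lc_jacobi : forall a b c : lc_sort,
    vsubst (fun w => vev 'X%:P (lc_br a w)) 'X (lc_br b c) =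
    vsubst (fun w => vev ('X%:P + 'X) (lc_br w c)) 'X%:P (lc_br a b) +
    vsubst (fun w => vev 'X (lc_br b w)) 'X%:P (lc_br a c)
}.

Record confModule (K : fieldType) (A : lieConformal K) := ConfModule {
  cm_sort :> lmodType {poly K};
  cm_act : A -> cm_sort -> vpoly cm_sort;
  cm_bilinear : bilinear_into cm_act;
  cm_dl : forall (a : A) (v : cm_sort), cm_act ('X *: a) v = (- 'X) *: cm_act a v;
  cm_dr : forall (a : A) (v : cm_sort),
    cm_act a ('X *: v) = ('X%:P + 'X) *: cm_act a v;
  cm_jacobi : forall (a b : A) (v : cm_sort),
    vsubst (fun w => vev 'X%:P (cm_act a w)) 'X (cm_act b v) -
    vsubst (fun w => vev 'X (cm_act b w)) 'X%:P (cm_act a v) =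
    vsubst (fun w => vev ('X%:P + 'X) (cm_act w v)) 'X%:P (lc_br a b)
}.

Section ConfModuleNotions.
Variables (K : fieldType) (A : lieConformal K).
Implicit Types V W : confModule A.

Definition cm_finite V : Prop :=
  exists (n : nat) (g : 'I_n -> V),
    forall v : V, exists c : 'I_n -> {poly K}, v = \sum_(i < n) c i *: g i.

Definition cm_submodule V (U : V -> Prop) : Prop :=
  [/\ U 0,
      forall u v, U u -> U v -> U (u + v),
      forall (c : {poly K}) u, U u -> U (c *: u) &
      forall (a : A) u n, U u -> U (cm_act a u n)].

Definition cm_irreducible V : Prop :=
  (exists v : V, v <> 0) /\
  forall U : V -> Prop, cm_submodule U ->
    (forall v, U v -> v = 0) \/ (forall v, U v).

Definition cm_trivial V : Prop := forall (a : A) (v : V), cm_act a v = 0.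

Definition cm_isomorphic V W : Prop :=
  exists f : {linear V -> W}, bijective f /\
    forall (a : A) (v : V) n, cm_act a (f v) n = f (cm_act a v n).

End ConfModuleNotions.

Section VsubstTheory.
Variables (V : zmodType) (S : nzRingType) (W : lmodType S).
Variables (iota : V -> W) (iotaD : {morph iota : x y / x + y}) (x : S).

Let iota0 : iota 0 = 0.
Proof. by apply: (addrI (iota 0)); rewrite -iotaD !addr0. Qed.

Lemma vsubst_widen N u : (vsize u <= N)%N ->
  vsubst iota x u = \sum_(n < N) x ^+ n *: iota (u n).
Proof.
move=> h; rewrite vsubst.unlock (big_ord_widen N (fun n => x ^+ n *: iota (u n))) //.
rewrite big_mkcond; apply: eq_bigr => n _; case: leqP => // hn.
by rewrite vsizeP // iota0 scaler0.
Qed.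

Lemma vsubstD : {morph vsubst iota x : u v / u + v}.
Proof.
move=> u v; pose N := maxn (vsize (u + v)) (maxn (vsize u) (vsize v)).
rewrite !(@vsubst_widen N) ?leq_max ?leqnn ?orbT // -big_split /=.
by apply: eq_bigr => n _; rewrite vcoefD iotaD scalerDr.
Qed.

Lemma vsubst_const v : vsubst iota x (vconst v) = iota v.
Proof.
rewrite (@vsubst_widen (vsize (vconst v)).+1) // big_ord_recl expr0 scale1r.
rewrite vconstE big1 ?addr0 // => i _.
by rewrite vconstE iota0 scaler0.
Qed.

End VsubstTheory.

Section VsubstZ.
Variables (R : nzRingType) (V : lmodType R) (S : comNzRingType) (W : lmodType S).
Variables (iota : V -> W) (iotaD : {morph iota : x y / x + y}).
Variables (phi : {rmorphism R -> S}).
Hypothesis iotaZ : forall c v, iota (c *: v) = phi c *: iota v.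
Variable x : S.

Lemma vsubstZconst (P : {poly R}) v :
  vsubst iota x (P *: vconst v) = (map_poly phi P).[x] *: iota v.
Proof.
have iota0 : iota 0 = 0 by apply: (addrI (iota 0)); rewrite -iotaD !addr0.
pose N := maxn (vsize (P *: vconst v)) (size P).
rewrite (@vsubst_widen _ _ _ _ iotaD x N) ?leq_max ?leqnn //.
have hs : (size (map_poly phi P) <= N)%N.
  by apply: leq_trans (size_poly _ _) _; rewrite leq_max leqnn orbT.
rewrite (horner_coef_wide x hs) scaler_suml; apply: eq_bigr => n _.
rewrite coef_map mulrC -scalerA; congr (_ *: _).
rewrite vcoefZ big_ord_recr /= subnn vconstE big1 ?add0r ?iotaZ // => i _.
have : (0 < n - i)%N by rewrite subn_gt0.
by rewrite vconstE; case: (n - i)%N => // m _; rewrite scaler0.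
Qed.

End VsubstZ.

Section BrAlg.
Variables (S : comNzRingType) (W : lmodType S).
Implicit Types (L H : W) (p q r s t c d l m x : S).

Lemma lin2E L H p q r s : (p *: L + q *: H) + (r *: L + s *: H) =
  (p + r) *: L + (q + s) *: H.
Proof. by rewrite addrACA -!scalerDl. Qed.

Lemma lin2Z L H c p q : c *: (p *: L + q *: H) = (c * p) *: L + (c * q) *: H.
Proof. by rewrite scalerDr !scalerA. Qed.

(** The common shape of all the brackets computed below. *)
Definition brS L H p q r s m : W :=
  (p * r * m) *: L + ((p * s + q * r) * m) *: H.

Lemma brSl L H c p q p' q' r s m :
  brS L H (c * p + p') (c * q + q') r s m =
  c *: brS L H p q r s m + brS L H p' q' r s m.
Proof. by rewrite /brS lin2Z lin2E; congr (_ *: _ + _ *: _); ring. Qed.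

Lemma brSr L H c p q r s r' s' m :
  brS L H p q (c * r + r') (c * s + s') m =
  c *: brS L H p q r s m + brS L H p q r' s' m.
Proof. by rewrite /brS lin2Z lin2E; congr (_ *: _ + _ *: _); ring. Qed.

Lemma brSDl L H p q p' q' r s m :
  brS L H (p + p') (q + q') r s m = brS L H p q r s m + brS L H p' q' r s m.
Proof. by rewrite /brS lin2E; congr (_ *: _ + _ *: _); ring. Qed.

Lemma brSDr L H p q r s r' s' m :
  brS L H p q (r + r') (s + s') m = brS L H p q r s m + brS L H p q r' s' m.
Proof. by rewrite /brS lin2E; congr (_ *: _ + _ *: _); ring. Qed.

Lemma brSZl L H c p q r s m :
  brS L H (c * p) (c * q) r s m = c *: brS L H p q r s m.
Proof. by rewrite /brS lin2Z; congr (_ *: _ + _ *: _); ring. Qed.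

Lemma brSZr L H c p q r s m :
  brS L H p q (c * r) (c * s) m = c *: brS L H p q r s m.
Proof. by rewrite /brS lin2Z; congr (_ *: _ + _ *: _); ring. Qed.

Lemma brSLL L H m : brS L H 1 0 1 0 m = m *: L.
Proof. by rewrite /brS !mul1r mul0r addr0 mul0r scale0r addr0. Qed.
Lemma brSLH L H m : brS L H 1 0 0 1 m = m *: H.
Proof. by rewrite /brS !mul1r !mul0r addr0 mul1r scale0r add0r. Qed.
Lemma brSHH L H m : brS L H 0 1 0 1 m = 0.
Proof. by rewrite /brS !mul0r mulr0 addr0 mul0r !scale0r addr0. Qed.

Lemma brS_skew L H p q r s d l :
  brS L H p q r s (d + l *+ 2) = - brS L H r s p q (d + (- l - d) *+ 2).
Proof.
by rewrite -[RHS]scaleN1r /brS lin2Z; congr (_ *: _ + _ *: _); ring.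
Qed.

Lemma brS_jacobi L H p q r s t x d l m :
  brS (brS L H p q 1 0 (d + l *+ 2)) (brS L H p q 0 1 (d + l *+ 2))
    r s t x (d + l + m *+ 2) =
  brS (brS L H 1 0 t x (d + (l + m) *+ 2)) (brS L H 0 1 t x (d + (l + m) *+ 2))
    p q r s (- (l + m) + l *+ 2) +
  brS (brS L H r s 1 0 (d + m *+ 2)) (brS L H r s 0 1 (d + m *+ 2))
    p q t x (d + m + l *+ 2).
Proof.
by rewrite /brS !lin2Z !lin2E; congr (_ *: _ + _ *: _); ring.
Qed.

Lemma actS_linl (v : W) c p q r m : ((c * p + q) * r * m) *: v = c *: ((p * r * m) *: v) + (q * r * m) *: v.
Proof. by rewrite ?scalerA -?scalerDl; congr (_ *: _); ring. Qed.
Lemma actS_linr (v : W) c p r s m : (p * (c * r + s) * m) *: v = c *: ((p * r * m) *: v) + (p * s * m) *: v.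
Proof. by rewrite ?scalerA -?scalerDl; congr (_ *: _); ring. Qed.
Lemma actS_Zl (v : W) c p r m : ((c * p) * r * m) *: v = c *: ((p * r * m) *: v).
Proof. by rewrite ?scalerA -?scalerDl; congr (_ *: _); ring. Qed.
Lemma actS_Zr (v : W) c p r m : (p * (c * r) * m) *: v = c *: ((p * r * m) *: v).
Proof. by rewrite ?scalerA -?scalerDl; congr (_ *: _); ring. Qed.
Lemma actS_Dl (v : W) p q r m : ((p + q) * r * m) *: v = (p * r * m) *: v + (q * r * m) *: v.
Proof. by rewrite ?scalerA -?scalerDl; congr (_ *: _); ring. Qed.
Lemma actS_Dr (v : W) p r s m : (p * (r + s) * m) *: v = (p * r * m) *: v + (p * s * m) *: v.
Proof. by rewrite ?scalerA -?scalerDl; congr (_ *: _); ring. Qed.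

Lemma actS_jacobi (v : W) p r s q t d l m (al De : S) :
  (r * t * (d + l + al + De * m)) *: ((p * 1 * (d + al + De * l)) *: v) -
  (p * t * (d + m + al + De * l)) *: ((r * 1 * (d + al + De * m)) *: v) =
  brS ((1 * t * (d + al + De * (l + m))) *: v)
      ((0 * t * (d + al + De * (l + m))) *: v)
    p q r s (- (l + m) + l *+ 2).
Proof.
by rewrite /brS !scalerA -scaleNr -!scalerDl; congr (_ *: _); ring.
Qed.

End BrAlg.

Section W22.
Variable K : fieldType.
Implicit Types p q r : {poly K}.

(** p(-λ) and p(∂+λ) in C[∂][λ]; [p^:P] is p(λ). *)
Definition at_ml p : {poly {poly K}} := p^:P \Po (- 'X).
Definition at_dl p : {poly {poly K}} := p^:P \Po ('X%:P + 'X).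

Lemma at_mlD : {morph at_ml : p q / p + q}.
Proof. by move=> p q; rewrite /at_ml !rmorphD. Qed.
Lemma at_mlM : {morph at_ml : p q / p * q}.
Proof. by move=> p q; rewrite /at_ml !rmorphM. Qed.
Lemma at_dlD : {morph at_dl : p q / p + q}.
Proof. by move=> p q; rewrite /at_dl !rmorphD. Qed.
Lemma at_dlM : {morph at_dl : p q / p * q}.
Proof. by move=> p q; rewrite /at_dl !rmorphM. Qed.
Lemma at_mlC c : at_ml c%:P = c%:P%:P.
Proof. by rewrite /at_ml map_polyC comp_polyC. Qed.
Lemma at_dlC c : at_dl c%:P = c%:P%:P.
Proof. by rewrite /at_dl map_polyC comp_polyC. Qed.
Lemma at_mlX : at_ml 'X = - 'X.
Proof. by rewrite /at_ml map_polyX comp_polyX. Qed.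
Lemma at_dlX : at_dl 'X = 'X%:P + 'X.
Proof. by rewrite /at_dl map_polyX comp_polyX. Qed.

Definition w22_car : lmodType {poly K} := ({poly K}^o * {poly K}^o)%type.
Definition w22_L : w22_car := (1, 0).
Definition w22_H : w22_car := (0, 1).

(** The bracket of a = p L + q H and b = r L + s H is obtained from the
    brackets of L and H by sesquilinearity: the coefficients of a are evaluated
    at -λ, those of b at ∂+λ; [H_λ L] = (∂+2λ)H follows from [L_λ H] and
    skew-symmetry.                                                           *)
Definition w22_br (a b : w22_car) : vpoly w22_car :=
  (at_ml a.1 * at_dl b.1 * ('X%:P + 'X *+ 2)) *: vconst w22_L +
  ((at_ml a.1 * at_dl b.2 + at_ml a.2 * at_dl b.1) * ('X%:P + 'X *+ 2))
    *: vconst w22_H.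

Let w22_brE a b : w22_br a b = brS (vconst w22_L) (vconst w22_H)
  (at_ml a.1) (at_ml a.2) (at_dl b.1) (at_dl b.2) ('X%:P + 'X *+ 2).
Proof. by []. Qed.

Let car1 (c : {poly K}) (a b : w22_car) : (c *: a + b).1 = c * a.1 + b.1.
Proof. by []. Qed.
Let car2 (c : {poly K}) (a b : w22_car) : (c *: a + b).2 = c * a.2 + b.2.
Proof. by []. Qed.
Let carZ1 (c : {poly K}) (a : w22_car) : (c *: a).1 = c * a.1.
Proof. by []. Qed.
Let carZ2 (c : {poly K}) (a : w22_car) : (c *: a).2 = c * a.2.
Proof. by []. Qed.

Fact w22_bilinear : bilinear_into w22_br.
Proof.
split=> c a b d; rewrite !w22_brE !car1 !car2.
  by rewrite !at_mlD !at_mlM !at_mlC brSl.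
by rewrite !at_dlD !at_dlM !at_dlC brSr.
Qed.

Fact w22_dl (a b : w22_car) : w22_br ('X *: a) b = (- 'X) *: w22_br a b.
Proof. by rewrite !w22_brE !carZ1 !carZ2 !at_mlM at_mlX brSZl. Qed.

Fact w22_dr (a b : w22_car) : w22_br a ('X *: b) = ('X%:P + 'X) *: w22_br a b.
Proof. by rewrite !w22_brE !carZ1 !carZ2 !at_dlM at_dlX brSZr. Qed.

Section Ev.
Variables (S : comNzRingType) (phi : {rmorphism {poly K} -> S}).
Variables (kappa : {rmorphism K -> S}) (e : forall c, phi c%:P = kappa c).

Definition pev (x : S) p : S := (map_poly kappa p).[x].

Lemma pevD x : {morph pev x : p q / p + q}.
Proof. by move=> p q; rewrite /pev rmorphD hornerD. Qed.
Lemma pevM x : {morph pev x : p q / p * q}.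
Proof. by move=> p q; rewrite /pev rmorphM hornerM. Qed.
Lemma pev0 x : pev x 0 = 0. Proof. by rewrite /pev rmorph0 horner0. Qed.
Lemma pev1 x : pev x 1 = 1. Proof. by rewrite /pev rmorph1 hornerC. Qed.

Let ev (x : S) (P : {poly {poly K}}) : S := (map_poly phi P).[x].
Let evD x P Q : ev x (P + Q) = ev x P + ev x Q.
Proof. by rewrite /ev rmorphD hornerD. Qed.
Let evM x P Q : ev x (P * Q) = ev x P * ev x Q.
Proof. by rewrite /ev rmorphM hornerM. Qed.
Let evN x P : ev x (- P) = - ev x P.
Proof. by rewrite /ev rmorphN hornerN. Qed.
Let evX x : ev x 'X = x. Proof. by rewrite /ev map_polyX hornerX. Qed.
Let evC x c : ev x c%:P = phi c. Proof. by rewrite /ev map_polyC hornerC. Qed.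

Let ev_comp p (q : {poly {poly K}}) (x : S) :
  ev x (p^:P \Po q) = pev (ev x q) p.
Proof.
rewrite /ev /pev map_comp_poly horner_comp; congr (_.[_]).
by rewrite -map_poly_comp; apply: eq_map_poly => c /=; rewrite e.
Qed.

Let ev_ml x p : ev x (at_ml p) = pev (- x) p.
Proof. by rewrite ev_comp evN evX. Qed.
Let ev_dl x p : ev x (at_dl p) = pev (phi 'X + x) p.
Proof. by rewrite ev_comp evD evX evC. Qed.

Variables (V : lmodType {poly K}) (W : lmodType S) (iota : V -> W).
Hypothesis iotaD : {morph iota : x y / x + y}.
Hypothesis iotaZ : forall c v, iota (c *: v) = phi c *: iota v.

Lemma vsubst_brS x (L H : V) p q r s :
  vsubst iota x (brS (vconst L) (vconst H)
    (at_ml p) (at_ml q) (at_dl r) (at_dl s) ('X%:P + 'X *+ 2)) =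
  brS (iota L) (iota H) (pev (- x) p) (pev (- x) q)
    (pev (phi 'X + x) r) (pev (phi 'X + x) s) (phi 'X + x *+ 2).
Proof.
rewrite /brS (vsubstD iotaD) !(vsubstZconst iotaD iotaZ) -!/(ev x _).
by rewrite !(evM, evD) evC evX !ev_ml !ev_dl mulr2n.
Qed.

Lemma vsubst_actS x (v : V) p q (al De : K) :
  vsubst iota x
   ((at_ml p * at_dl q * ('X%:P + al%:P%:P + De%:P%:P * 'X)) *: vconst v) =
  (pev (- x) p * pev (phi 'X + x) q * (phi 'X + kappa al + kappa De * x))
    *: iota v.
Proof.
rewrite (vsubstZconst iotaD iotaZ) -!/(ev x _).
by rewrite !evM !evD !evM !evC !evX !ev_ml !ev_dl !e.
Qed.

End Ev.

Fact w22_skew (a b : w22_car) :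
  w22_br a b = - vsubst (@vconst w22_car) (- 'X - 'X%:P) (w22_br b a).
Proof.
pose kappa2 : {rmorphism K -> {poly {poly K}}} := polyC \o polyC.
have e2 (c : K) : polyC c%:P = kappa2 c by [].
have atE p (q : {poly {poly K}}) : p^:P \Po q = pev kappa2 q p.
  by rewrite /comp_poly -map_poly_comp.
rewrite !w22_brE (vsubst_brS e2 (@vconstD w22_car) (@vconstZ _ w22_car)).
rewrite brS_skew /at_ml /at_dl !atE.
have -> : - (- 'X - 'X%:P) = 'X%:P + 'X :> {poly {poly K}}.
  by rewrite opprD !opprK addrC.
have -> // : polyC 'X + (- 'X - 'X%:P) = - 'X :> {poly {poly K}}.
by rewrite addrCA subrr addr0.
Qed.

Let S3 := {poly {poly {poly K}}}.
Let kappa3 : {rmorphism K -> S3} := (polyC \o (polyC \o polyC)).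
Let phi1 : {rmorphism {poly K} -> S3} := (polyC \o polyC).
Let phi2 (y : S3) : {rmorphism {poly K} -> S3} :=
  (horner_eval y \o map_poly kappa3).

Let e1 (c : K) : phi1 c%:P = kappa3 c. Proof. by []. Qed.
Let e2 y (c : K) : phi2 y c%:P = kappa3 c.
Proof. by rewrite /phi2 /= map_polyC /horner_eval hornerC. Qed.
Let phi1X : phi1 'X = 'X%:P%:P. Proof. by []. Qed.
Let phi2X y : phi2 y 'X = y.
Proof. by rewrite /phi2 /= map_polyX /horner_eval hornerX. Qed.
Let phi2E y p : phi2 y p = pev kappa3 y p. Proof. by []. Qed.

Section Vev.
Variable V : lmodType {poly K}.
Let vv (v : V) := vconst (vconst v).
Let vvD : {morph vv : x y / x + y}.
Proof. by move=> x y; rewrite /vv !vconstD. Qed.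
Let vvZ c v : vv (c *: v) = phi1 c *: vv v.
Proof. by rewrite /vv !vconstZ. Qed.

Lemma vev_br x (L H : V) p q r s :
  vev x (brS (vconst L) (vconst H)
    (at_ml p) (at_ml q) (at_dl r) (at_dl s) ('X%:P + 'X *+ 2)) =
  brS (vv L) (vv H) (pev kappa3 (- x) p) (pev kappa3 (- x) q)
    (pev kappa3 ('X%:P%:P + x) r) (pev kappa3 ('X%:P%:P + x) s)
    ('X%:P%:P + x *+ 2).
Proof. exact: (vsubst_brS e1 vvD vvZ). Qed.

Lemma vev_act x (v : V) p q (al De : K) :
  vev x
   ((at_ml p * at_dl q * ('X%:P + al%:P%:P + De%:P%:P * 'X)) *: vconst v) =
  (pev kappa3 (- x) p * pev kappa3 ('X%:P%:P + x) q *
    ('X%:P%:P + kappa3 al + kappa3 De * x)) *: vv v.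
Proof.
exact: (vsubst_actS e1 vvD vvZ).
Qed.
End Vev.

Let L3 : vpoly (vpoly w22_car) := vconst (vconst w22_L).
Let H3 : vpoly (vpoly w22_car) := vconst (vconst w22_H).

Let vevE x a b : vev x (w22_br a b) = brS L3 H3
  (pev kappa3 (- x) a.1) (pev kappa3 (- x) a.2)
  (pev kappa3 ('X%:P%:P + x) b.1) (pev kappa3 ('X%:P%:P + x) b.2)
  ('X%:P%:P + x *+ 2).
Proof. exact: vev_br. Qed.

Let at_ml0 : at_ml 0 = 0. Proof. by rewrite /at_ml rmorph0 comp_poly0. Qed.
Let at_dl0 : at_dl 0 = 0. Proof. by rewrite /at_dl rmorph0 comp_poly0. Qed.
Let at_ml1 : at_ml 1 = 1. Proof. by rewrite at_mlC. Qed.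
Let at_dl1 : at_dl 1 = 1. Proof. by rewrite at_dlC. Qed.
Let at01 := (at_ml0, at_dl0, at_ml1, at_dl1).

Let L1 : w22_L.1 = 1 :> {poly K}. Proof. by []. Qed.
Let L2 : w22_L.2 = 0 :> {poly K}. Proof. by []. Qed.
Let H1 : w22_H.1 = 0 :> {poly K}. Proof. by []. Qed.
Let H2 : w22_H.2 = 1 :> {poly K}. Proof. by []. Qed.

Let brLL : w22_br w22_L w22_L = ('X%:P + 'X *+ 2) *: vconst w22_L.
Proof. by rewrite w22_brE L1 L2 !at01 brSLL. Qed.
Let brLH : w22_br w22_L w22_H = ('X%:P + 'X *+ 2) *: vconst w22_H.
Proof. by rewrite w22_brE L1 L2 H1 H2 !at01 brSLH. Qed.
Let brHH : w22_br w22_H w22_H = 0.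
Proof. by rewrite w22_brE H1 H2 !at01 brSHH. Qed.

#[local] Opaque w22_br vev pev at_ml at_dl.

Let carD1 (a b : w22_car) : (a + b).1 = a.1 + b.1. Proof. by []. Qed.
Let carD2 (a b : w22_car) : (a + b).2 = a.2 + b.2. Proof. by []. Qed.

Let vevrD x a : {morph (fun w => vev x (w22_br a w)) : u v / u + v}.
Proof.
move=> u v; apply: etrans (vevE x a (u + v)) _.
apply: etrans _ (esym (f_equal2 +%R (vevE x a u) (vevE x a v))).
apply: etrans _ (brSDr _ _ _ _ _ _ _ _ _).
by congr brS; exact: pevD.
Qed.
Let vevrZ x a c v : vev x (w22_br a (c *: v)) =
  phi2 ('X%:P%:P + x) c *: vev x (w22_br a v).
Proof.
apply: etrans (vevE x a (c *: v)) _.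
apply: etrans _ (esym (f_equal _ (vevE x a v))).
apply: etrans _ (brSZr _ _ _ _ _ _ _ _).
by congr brS; exact: pevM.
Qed.
Let vevlD x b : {morph (fun w => vev x (w22_br w b)) : u v / u + v}.
Proof.
move=> u v; apply: etrans (vevE x (u + v) b) _.
apply: etrans _ (esym (f_equal2 +%R (vevE x u b) (vevE x v b))).
apply: etrans _ (brSDl _ _ _ _ _ _ _ _ _).
by congr brS; exact: pevD.
Qed.
Let vevlZ x b c v : vev x (w22_br (c *: v) b) =
  phi2 (- x) c *: vev x (w22_br v b).
Proof.
apply: etrans (vevE x (c *: v) b) _.
apply: etrans _ (esym (f_equal _ (vevE x v b))).
apply: etrans _ (brSZl _ _ _ _ _ _ _ _).
by congr brS; exact: pevM.
Qed.

Let rot1 : - ('X%:P + 'X) + 'X%:P = - 'X :> S3.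
Proof. by rewrite opprD addrAC addNr add0r. Qed.
Let rot2 : 'X%:P%:P + 'X%:P + 'X = 'X%:P%:P + ('X%:P + 'X) :> S3.
Proof. by rewrite addrA. Qed.
Let rot3 : 'X%:P%:P + 'X + 'X%:P = 'X%:P%:P + ('X%:P + 'X) :> S3.
Proof. by rewrite -addrA (addrC 'X). Qed.

#[local] Opaque w22_L w22_H.

Let vev_rL x a : vev x (w22_br a w22_L) = brS L3 H3
  (pev kappa3 (- x) a.1) (pev kappa3 (- x) a.2) 1 0 ('X%:P%:P + x *+ 2).
Proof. by rewrite vevE pev1 pev0. Qed.
Let vev_rH x a : vev x (w22_br a w22_H) = brS L3 H3
  (pev kappa3 (- x) a.1) (pev kappa3 (- x) a.2) 0 1 ('X%:P%:P + x *+ 2).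
Proof. by rewrite vevE pev1 pev0. Qed.
Let vev_lL x b : vev x (w22_br w22_L b) = brS L3 H3 1 0
  (pev kappa3 ('X%:P%:P + x) b.1) (pev kappa3 ('X%:P%:P + x) b.2)
  ('X%:P%:P + x *+ 2).
Proof. by rewrite vevE pev1 pev0. Qed.
Let vev_lH x b : vev x (w22_br w22_H b) = brS L3 H3 0 1
  (pev kappa3 ('X%:P%:P + x) b.1) (pev kappa3 ('X%:P%:P + x) b.2)
  ('X%:P%:P + x *+ 2).
Proof. by rewrite vevE pev1 pev0. Qed.

Let jac_sub (phi : {rmorphism {poly K} -> S3})
    (e : forall c, phi c%:P = kappa3 c)
    (iota : w22_car -> vpoly (vpoly w22_car))
    (iotaD : {morph iota : x y / x + y})
    (iotaZ : forall c v, iota (c *: v) = phi c *: iota v)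
    x y z (a b : w22_car) L H :
  iota w22_L = L -> iota w22_H = H -> phi 'X = y -> y + x = z ->
  vsubst iota x (w22_br a b) = brS L H
    (pev kappa3 (- x) a.1) (pev kappa3 (- x) a.2)
    (pev kappa3 z b.1) (pev kappa3 z b.2) (y + x *+ 2).
Proof.
move=> <- <- <- <-.
rewrite w22_brE; exact: (vsubst_brS e iotaD iotaZ).
Qed.

Fact w22_jacobi (a b c : w22_car) :
  vsubst (fun w => vev 'X%:P (w22_br a w)) 'X (w22_br b c) =
  vsubst (fun w => vev ('X%:P + 'X) (w22_br w c)) 'X%:P (w22_br a b) +
  vsubst (fun w => vev 'X (w22_br b w)) 'X%:P (w22_br a c).
Proof.
apply: etrans (jac_sub (@e2 _) (@vevrD _ a) (@vevrZ _ a) b c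
  (vev_rL _ _) (vev_rH _ _) (phi2X _) rot2) _.
apply: etrans _ (esym (f_equal2 +%R
  (jac_sub (@e2 _) (@vevlD _ c) (@vevlZ _ c) a b
    (vev_lL _ _) (vev_lH _ _) (phi2X _) rot1)
  (jac_sub (@e2 _) (@vevrD _ b) (@vevrZ _ b) a c
    (vev_rL _ _) (vev_rH _ _) (phi2X _) rot3))).
exact: brS_jacobi.
Qed.

Definition w22 : lieConformal K :=
  LieConformal w22_bilinear w22_dl w22_dr w22_skew w22_jacobi.

(** The defining relations of the algebra, in terms of its basis L, H. *)

Lemma w22_basis (a : w22) : exists! c : {poly K} * {poly K},
  a = c.1 *: (w22_L : w22) + c.2 *: (w22_H : w22).
Proof.
have E (p q : {poly K}) : p *: w22_L + q *: w22_H = (p, q) :> w22_car.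
  rewrite [LHS]surjective_pairing carD1 carD2 !carZ1 !carZ2 /=.
  by rewrite !mulr0 !mulr1 addr0 add0r.
case: a => p q; exists (p, q); split=> [|[p' q']]; first exact/esym/E.
by move=> h; rewrite -[RHS]E; exact: (etrans h).
Qed.

Lemma w22_LL : lc_br (w22_L : w22) w22_L =
  ('X%:P + 'X *+ 2) *: vconst (w22_L : w22).
Proof. exact: brLL. Qed.

Lemma w22_LH : lc_br (w22_L : w22) w22_H =
  ('X%:P + 'X *+ 2) *: vconst (w22_H : w22).
Proof. exact: brLH. Qed.

Lemma w22_HH : lc_br (w22_H : w22) w22_H = 0.
Proof. exact: brHH. Qed.

(** The module M_{Δ,α} = C[∂]v, with v = 1 : the action of p L + q H on f v is
    the sesquilinear extension of L_λ v = (∂+α+Δλ)v and H_λ v = 0.           *)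

#[local] Opaque brS.

Section ModM.
Variables Delta alpha : K.

Definition modM_car : lmodType {poly K} := {poly K}^o.
Definition modM_v : modM_car := 1.

Definition modM_act (a : w22) (f : modM_car) : vpoly modM_car :=
  (at_ml a.1 * at_dl f * ('X%:P + alpha%:P%:P + Delta%:P%:P * 'X))
    *: vconst modM_v.

Let fZ (c : {poly K}) (f : modM_car) : c *: f = (c : {poly K}) * f.
Proof. by []. Qed.

Fact modM_bilinear : bilinear_into modM_act.
Proof.
split=> c a b d; rewrite /modM_act.
  by rewrite car1 at_mlD at_mlM at_mlC; exact: actS_linl.
by rewrite fZ at_dlD at_dlM at_dlC; exact: actS_linr.
Qed.

Fact modM_dl (a : w22) (f : modM_car) :
  modM_act ('X *: a) f = (- 'X) *: modM_act a f.
Proof. by rewrite /modM_act carZ1 at_mlM at_mlX; exact: actS_Zl. Qed.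

Fact modM_dr (a : w22) (f : modM_car) :
  modM_act a ('X *: f) = ('X%:P + 'X) *: modM_act a f.
Proof. by rewrite /modM_act fZ at_dlM at_dlX; exact: actS_Zr. Qed.

Let actL : modM_act w22_L modM_v =
  ('X%:P + alpha%:P%:P + Delta%:P%:P * 'X) *: vconst modM_v.
Proof. by rewrite /modM_act L1 at_ml1 at_dl1 !mul1r. Qed.
Let actH : modM_act w22_H modM_v = 0.
Proof. by rewrite /modM_act H1 at_ml0 !mul0r scale0r. Qed.

#[local] Opaque modM_act modM_v.

Let v3 : vpoly (vpoly modM_car) := vconst (vconst modM_v).

Let vevM x (a : w22) (f : modM_car) : vev x (modM_act a f) =
  (pev kappa3 (- x) a.1 * pev kappa3 ('X%:P%:P + x) f *
    ('X%:P%:P + kappa3 alpha + kappa3 Delta * x)) *: v3.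
Proof. exact: vev_act. Qed.

Let mrD x a : {morph (fun w => vev x (modM_act a w)) : u v / u + v}.
Proof.
move=> u v; apply: etrans (vevM x a (u + v)) _.
apply: etrans _ (esym (f_equal2 +%R (vevM x a u) (vevM x a v))).
by apply: etrans _ (actS_Dr _ _ _ _ _); rewrite (pevD _ _ u v).
Qed.
Let mrZ x a (r : {poly K}) v : vev x (modM_act a (r *: v)) =
  phi2 ('X%:P%:P + x) r *: vev x (modM_act a v).
Proof.
apply: etrans (vevM x a (r *: v)) _.
apply: etrans _ (esym (f_equal _ (vevM x a v))).
by apply: etrans _ (actS_Zr _ _ _ _ _); rewrite fZ (pevM _ _ r v).
Qed.
Let mlD x f : {morph (fun w => vev x (modM_act w f)) : u v / u + v}.
Proof.
move=> u v; apply: etrans (vevM x (u + v) f) _.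
apply: etrans _ (esym (f_equal2 +%R (vevM x u f) (vevM x v f))).
by apply: etrans _ (actS_Dl _ _ _ _ _); rewrite (carD1 u v) (pevD _ _ u.1 v.1).
Qed.
Let mlZ x f (r : {poly K}) v : vev x (modM_act (r *: v) f) =
  phi2 (- x) r *: vev x (modM_act v f).
Proof.
apply: etrans (vevM x (r *: v) f) _.
apply: etrans _ (esym (f_equal _ (vevM x v f))).
by apply: etrans _ (actS_Zl _ _ _ _ _); rewrite (carZ1 r v) (pevM _ _ r v.1).
Qed.

Let act_sub (phi : {rmorphism {poly K} -> S3})
    (e : forall c, phi c%:P = kappa3 c)
    (iota : modM_car -> vpoly (vpoly modM_car))
    (iotaD : {morph iota : x y / x + y})
    (iotaZ : forall (c : {poly K}) v, iota (c *: v) = phi c *: iota v)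
    x y z (a : w22_car) f v :
  iota modM_v = v -> phi 'X = y -> y + x = z ->
  vsubst iota x (modM_act a f) =
  (pev kappa3 (- x) a.1 * pev kappa3 z f * (y + kappa3 alpha + kappa3 Delta * x))
    *: v.
Proof. by move=> <- <- <-; exact: (vsubst_actS e iotaD iotaZ). Qed.

Let bra_sub (phi : {rmorphism {poly K} -> S3})
    (e : forall c, phi c%:P = kappa3 c)
    (iota : w22_car -> vpoly (vpoly modM_car))
    (iotaD : {morph iota : x y / x + y})
    (iotaZ : forall c v, iota (c *: v) = phi c *: iota v)
    x y z (a b : w22_car) L H :
  iota w22_L = L -> iota w22_H = H -> phi 'X = y -> y + x = z ->
  vsubst iota x (w22_br a b) = brS L H
    (pev kappa3 (- x) a.1) (pev kappa3 (- x) a.2)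
    (pev kappa3 z b.1) (pev kappa3 z b.2) (y + x *+ 2).
Proof.
move=> <- <- <- <-.
rewrite w22_brE; exact: (vsubst_brS e iotaD iotaZ).
Qed.

Let vevM1 x a : vev x (modM_act a modM_v) =
  (pev kappa3 (- x) a.1 * 1 * ('X%:P%:P + kappa3 alpha + kappa3 Delta * x)) *: v3.
Proof. by rewrite vevM pev1. Qed.
Let vevML x f : vev x (modM_act w22_L f) =
  (1 * pev kappa3 ('X%:P%:P + x) f *
    ('X%:P%:P + kappa3 alpha + kappa3 Delta * x)) *: v3.
Proof. by rewrite vevM pev1. Qed.
Let vevMH x f : vev x (modM_act w22_H f) =
  (0 * pev kappa3 ('X%:P%:P + x) f *
    ('X%:P%:P + kappa3 alpha + kappa3 Delta * x)) *: v3.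
Proof. by rewrite vevM pev0. Qed.

Fact modM_jacobi (a b : w22) (f : modM_car) :
  vsubst (fun w => vev 'X%:P (modM_act a w)) 'X (modM_act b f) -
  vsubst (fun w => vev 'X (modM_act b w)) 'X%:P (modM_act a f) =
  vsubst (fun w => vev ('X%:P + 'X) (modM_act w f)) 'X%:P (lc_br a b).
Proof.
apply: etrans (f_equal2 (fun u v => u - v)
  (act_sub (@e2 _) (@mrD _ a) (@mrZ _ a) b f (vevM1 _ _) (phi2X _) rot2)
  (act_sub (@e2 _) (@mrD _ b) (@mrZ _ b) a f (vevM1 _ _) (phi2X _) rot3)) _.
apply: etrans _ (esym (bra_sub (@e2 _) (@mlD _ f) (@mlZ _ f) a b
    (vevML _ _) (vevMH _ _) (phi2X _) rot1)).
exact: actS_jacobi.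
Qed.

Definition modM : confModule w22 :=
  ConfModule modM_bilinear modM_dl modM_dr modM_jacobi.

Lemma modM_L : cm_act (w22_L : w22) (modM_v : modM) =
  ('X%:P + alpha%:P%:P + Delta%:P%:P * 'X) *: vconst (modM_v : modM).
Proof. exact: actL. Qed.

Lemma modM_H : cm_act (w22_H : w22) (modM_v : modM) = 0.
Proof. exact: actH. Qed.

End ModM.

End W22.

(* Main.v *)
From HB Require Import structures.
Require Import Defs.
From mathcomp Require Import all_boot all_order all_algebra.
From mathcomp Require Import boolp reals complex.

Set Implicit Arguments.
Unset Strict Implicit.
Unset Printing Implicit Defensive.

Import GRing.Theory.
Local Open Scope ring_scope.

(** Write L_λ = Σ λ^n l_n and H_λ = Σ λ^n h_n. On a finite irreducible nontrivial
    module, the vectors killed by l_n for n > N and by h_n for n >= N form a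
    finite-dimensional space, stable under h_n (n >= 0), l_n (n > 0) and ∂ - l_0,
    and nonzero for large N. A trace argument shows that C is singular on such a
    space when it is a multiple of [A, B] and commutes with B; it yields a nonzero
    vector killed by all h_n, hence H = 0 by irreducibility. As ∂ - l_0 commutes
    with the action, it is a scalar, so l_0 = ∂ + α. The same trace argument for
    [l_1, l_n] = (1 - n) l_n gives a nonzero vector killed by l_n for all n > 1,
    and an eigenvector v of l_1 among these vectors generates a submodule
    C[∂]v isomorphic to M_{Δ,α}. *)

(** * Finite-dimensional subspaces *)

Section FiniteDimensionalSubspaces.
Variables (K : fieldType) (W : lmodType K).
Implicit Types (U : W -> Prop) (f : W -> W).

Definition lincomb n (b : 'I_n -> W) (c : 'rV[K]_n) : W :=
  \sum_i c 0 i *: b i.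

Lemma lincomb_linear n (b : 'I_n -> W) : linear (lincomb b).
Proof.
move=> a c d; rewrite /lincomb scaler_sumr -big_split /=.
by apply: eq_bigr => i _; rewrite !mxE scalerDl scalerA.
Qed.

HB.instance Definition _ n (b : 'I_n -> W) :=
  GRing.isLinear.Build _ _ _ _ (lincomb b) (@lincomb_linear n b).

Definition subspace U : Prop :=
  U 0 /\ forall (c : K) u v, U u -> U v -> U (c *: u + v).

(** Unlike a statement about bases, this passes to subsets for free. *)
Definition fdim U : Prop :=
  exists d, forall n (x : 'I_n -> W), (d <= n)%N -> (forall i, U (x i)) ->
    exists2 c : 'rV[K]_n, c != 0 & lincomb x c = 0.

Definition stable U f : Prop := forall u, U u -> U (f u).

Lemma subspace_lincomb U n (x : 'I_n -> W) (c : 'rV[K]_n) :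
  subspace U -> (forall i, U (x i)) -> U (lincomb x c).
Proof.
move=> [U0 UD] Ux; rewrite /lincomb; elim/big_rec: _ => // i u _ Uu.
exact: UD.
Qed.

Lemma lincomb_mul m n (x : 'I_n -> W) (S : 'M[K]_(m, n)) (c : 'rV[K]_m) :
  lincomb (fun k => lincomb x (row k S)) c = lincomb x (c *m S).
Proof.
rewrite mulmx_sum_row linear_sum; apply: eq_bigr => k _.
by rewrite linearZ.
Qed.

Lemma fdim_sub U U' : (forall u, U' u -> U u) -> fdim U -> fdim U'.
Proof. by move=> sU [d h]; exists d => n x dn Ux; apply: h => // i; apply: sU. Qed.

Lemma fdim0 U : (forall u, U u -> u = 0) -> fdim U.
Proof.
move=> U0; exists 1 => -[//|n] x _ Ux; exists (const_mx 1).
  by apply/eqP => /rowP/(_ 0); rewrite !mxE; apply/eqP/oner_neq0.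
by rewrite /lincomb big1 // => i _; rewrite (U0 _ (Ux i)) scaler0.
Qed.

(** Rank-nullity: the coordinates of the f-images of n vectors form an n × D matrix, whose left
    kernel has rank at least d once n >= D + d; its rows give d vectors of U in the kernel of f. *)
Lemma fdim_ker U (f : {linear W -> W}) D (w : 'I_D -> W) : subspace U ->
  (forall u, U u -> exists c : 'rV[K]_D, f u = lincomb w c) ->
  fdim (fun u => U u /\ f u = 0) -> fdim U.
Proof.
move=> sU fw [d hd]; exists (D + d)%N => n x dn Ux.
have [r hr] := fin_all_exists (fun i => fw _ (Ux i)).
pose R : 'M[K]_(n, D) := \matrix_i r i.
have fx c : f (lincomb x c) = lincomb w (c *m R).
  rewrite -lincomb_mul /lincomb linear_sum; apply: eq_bigr => i _.
  by rewrite linearZ /= hr rowK.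
(* A free family of rows, so that a nonzero relation c yields the nonzero relation [c *m S]. *)
pose S := row_base (kermx R).
have SR0 : S *m R = 0 by apply/sub_kermxP; rewrite eq_row_base.
have dS : (d <= \rank (kermx R))%N.
  rewrite mxrank_ker leq_subRL ?rank_leq_row // (leq_trans _ dn) //.
  by rewrite leq_add2r rank_leq_col.
have [|c c0 xc] := hd _ (fun k => lincomb x (row k S)) dS.
  move=> k; split; first exact: subspace_lincomb.
  by rewrite fx -row_mul SR0 row0 linear0.
exists (c *m S); last by rewrite -lincomb_mul.
apply: contraNneq c0 => cS0.
by apply/eqP/(row_free_inj (row_base_free (kermx R))); rewrite cS0 mul0mx.
Qed.

Definition basis_on U n (b : 'I_n -> W) : Prop :=
  [/\ forall i, U (b i),
      forall c : 'rV[K]_n, lincomb b c = 0 -> c = 0 &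
      forall u, U u -> exists c : 'rV[K]_n, u = lincomb b c].

(** Without a basis, no free family in U spans U, so free families can be extended one vector at a
    time up to length d, which the bound forbids. *)
Lemma fdim_basis U : subspace U -> fdim U -> exists n (b : 'I_n -> W), basis_on U b.
Proof.
move=> [U0 UD] [d hd]; apply: contrapT => nob.
suff : exists2 x : 'I_d -> W, (forall i, U (x i)) &
    forall c : 'rV[K]_d, lincomb x c = 0 -> c = 0.
  case=> x Ux freex; have [c /eqP c0 xc] := hd d x (leqnn d) Ux.
  exact/c0/freex.
elim: (d) => [|k [x Ux freex]].
  by exists (fun=> 0) => [[]//|c _]; apply/rowP => -[].
have [u Uu nu] : exists2 u, U u & ~ exists c : 'rV[K]_k, u = lincomb x c.
  apply: contrapT => nu; apply: nob; exists k, x; split=> // u Uu.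
  by apply: contrapT => nc; apply: nu; exists u.
exists (fun i => oapp x u (unlift ord0 i)).
  by move=> i; case: unliftP => [j|] _ /=.
move=> c; rewrite /lincomb big_ord_recl unlift_none /=.
under eq_bigr do rewrite liftK /=.
pose c' := \row_j c 0 (lift ord0 j) => /eqP; have -> :
  \sum_(i < k) c 0 (lift ord0 i) *: x i = lincomb x c'.
  by apply: eq_bigr => i _; rewrite mxE.
move=> /eqP e; have c00 : c 0 ord0 = 0.
  apply: contrapT => /eqP c00; apply: nu; exists (- (c 0 ord0)^-1 *: c').
  apply: (scalerI c00); rewrite linearZ /= scalerA mulrN divff // scaleN1r.
  by apply/eqP; rewrite -addr_eq0 e.
move: e; rewrite c00 scale0r add0r => /freex /rowP c'0.
apply/rowP => i; rewrite mxE; case: (unliftP ord0 i) => [j|] -> //.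
by have := c'0 j; rewrite !mxE.
Qed.

Lemma basis_neq0 U n (b : 'I_n -> W) v : basis_on U b -> U v -> v <> 0 -> (0 < n)%N.
Proof.
case: n b => // b [_ _ gen] Uv nv; case: nv; have [c ->] := gen _ Uv.
by rewrite /lincomb big_ord0.
Qed.

Lemma stable_matrix U n (b : 'I_n -> W) (f : {linear W -> W}) :
  basis_on U b -> stable U f ->
  exists M : 'M[K]_n, forall r, f (lincomb b r) = lincomb b (r *m M).
Proof.
move=> [Ub _ gen] Uf.
have [r hr] := fin_all_exists (fun i => gen _ (Uf _ (Ub i))).
exists (\matrix_i r i) => c.
rewrite -lincomb_mul /lincomb linear_sum; apply: eq_bigr => i _.
by rewrite linearZ /= hr rowK.
Qed.

(* If C were invertible, A B C^-1 and B A C^-1 would have the same trace, since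
   C^-1 commutes with B, while their difference is the identity. *)
Lemma mx_comm_singular n (A B C : 'M[K]_n) : [pchar K] =i pred0 -> (0 < n)%N ->
  A *m B - B *m A = C -> B *m C = C *m B -> \det C = 0.
Proof.
move=> ch n0 eC eB; apply: contrapT => /eqP C0.
have uC : C \in unitmx by rewrite unitmxE unitfE.
have comB : B *m invmx C = invmx C *m B.
  by rewrite -[LHS](mulKmx uC) [C *m (B *m _)]mulmxA -eB mulmxK.
have : \tr (C *m invmx C) = 0.
  rewrite -{1}eC mulmxBl linearB /= -!mulmxA comB [A *m _]mulmxA.
  by rewrite (mxtrace_mulC (A *m _)) subrr.
rewrite mulmxV // mxtrace1 => /eqP; apply/negP.
by rewrite ((pcharf0P K).1 ch) -lt0n.
Qed.

(** This is [mx_comm_singular] read in coordinates on U. The factor a covers relations such as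
    [l_1, h_n] = (1 - n) h_n, where B and C coincide. *)
Lemma comm_singular U (A B C : {linear W -> W}) (a : K) v :
  [pchar K] =i pred0 -> a != 0 ->
  subspace U -> fdim U -> U v -> v <> 0 ->
  stable U A -> stable U B -> stable U C ->
  (forall u, U u -> A (B u) - B (A u) = a *: C u) ->
  (forall u, U u -> B (C u) = C (B u)) ->
  exists2 u, U u /\ C u = 0 & u <> 0.
Proof.
move=> ch a0 sU fU Uv nv UA UB UC eC eB.
have [n [b Bb]] := fdim_basis sU fU; have n0 := basis_neq0 Bb Uv nv.
have [MA hA] := stable_matrix Bb UA; have [MB hB] := stable_matrix Bb UB.
have [MC hC] := stable_matrix Bb UC; have [Ub freeb _] := Bb.
have Ue r : U (lincomb b r) by exact: subspace_lincomb.
have einj r s : lincomb b r = lincomb b s -> r = s.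
  move=> e; apply/eqP; rewrite -subr_eq0; apply/eqP/freeb.
  by rewrite linearB /= e subrr.
have mxinj (M N : 'M[K]_n) : (forall r : 'rV_n, r *m M = r *m N) -> M = N.
  by move=> e; apply/row_matrixP => i; rewrite !rowE.
have /eqP/det0P[r r0 rC] : \det MC = 0.
  (* Matrices act on row vectors from the right, so composition reverses products: hence the sign.
     The factor a^-1 absorbs a. *)
  have := @mx_comm_singular n (- (a^-1 *: MA)) MB MC ch n0; apply.
    apply: mxinj => r; apply/einj/(scalerI a0).
    rewrite -hC -eC // mulNmx mulmxN opprK addrC -scalemxAl -scalemxAr -scalerBr.
    rewrite -scalemxAr linearZ /= scalerA divff // scale1r mulmxBr linearB /=.
    by rewrite hB hA hA hB !mulmxA.
  by apply: mxinj => r; apply: einj; rewrite !mulmxA -hC -hB -hB -hC eB.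
exists (lincomb b r); first by rewrite hC rC linear0.
by move=> /freeb e; rewrite e eqxx in r0.
Qed.

End FiniteDimensionalSubspaces.

Lemma eigenvector_on (K : closedFieldType) (W : lmodType K) (U : W -> Prop)
    (f : {linear W -> W}) v :
  subspace U -> fdim U -> U v -> v <> 0 -> stable U f ->
  exists a u, [/\ U u, u <> 0 & f u = a *: u].
Proof.
move=> sU fU Uv nv Uf; have [n [b Bb]] := fdim_basis sU fU.
have n0 := basis_neq0 Bb Uv nv; have [M hM] := stable_matrix Bb Uf.
case: Bb => Ub freeb _.
have /closed_rootP[a] : size (char_poly M) != 1%N.
  by rewrite size_char_poly eqSS -lt0n.
rewrite -eigenvalue_root_char => /eigenvalueP[r rM r0].
exists a, (lincomb b r); split; first exact: subspace_lincomb.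
  by move=> /freeb e; rewrite e eqxx in r0.
by rewrite hM rM linearZ.
Qed.

(** * Coefficients of λ-actions *)

Section VpolyCoefficients.
Variables (R : nzRingType) (V : lmodType R).
Implicit Types (u : vpoly V) (p : {poly R}).

Lemma vpoly_eq0 u : (forall n, u n = 0) -> u = 0.
Proof. by move=> e; apply/vpolyP => n; rewrite e vcoef0. Qed.

Lemma vcoef_sum I (r : seq I) (P : pred I) (F : I -> vpoly V) n :
  (\sum_(i <- r | P i) F i) n = \sum_(i <- r | P i) F i n.
Proof.
by apply: (big_morph (fun u : vpoly V => u n)) => [u v|];
   rewrite ?vcoefD ?vcoef0.
Qed.

Lemma vcoefZC (c : R) u n : (c%:P *: u) n = c *: u n.
Proof.
rewrite vcoefZ big_ord_recl coefC subn0 big1 ?addr0 // => i _.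
by rewrite coefC scale0r.
Qed.

Lemma vcoefZXn u k n : ('X^k *: u) n = if (k <= n)%N then u (n - k)%N else 0.
Proof.
rewrite vcoefZ; case: leqP => kn; last first.
  rewrite big1 // => i _; rewrite coefXn; case: eqP => [e|]; last by rewrite scale0r.
  by have := ltn_ord i; rewrite e ltnS leqNgt kn.
have kn' : (k < n.+1)%N by [].
rewrite (bigD1 (Ordinal kn')) //= coefXn eqxx scale1r big1 ?addr0 // => i ik.
rewrite coefXn; case: eqP => [e|]; last by rewrite scale0r.
by move: ik; rewrite -val_eqE /= e eqxx.
Qed.

Lemma vcoefZX u n : ('X *: u) n = if n is m.+1 then u m else 0.
Proof. by rewrite -[in LHS](expr1 'X) vcoefZXn; case: n => //= n; rewrite subn1. Qed.

Lemma vcoefZvconst p (v : V) n : (p *: vconst v) n = p`_n *: v.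
Proof.
rewrite vcoefZ big_ord_recr /= subnn vconstE big1 ?add0r // => i _.
by rewrite vconstE -(subnSK (ltn_ord i)) scaler0.
Qed.

End VpolyCoefficients.

Section VsubstBound.
Variables (V : zmodType) (S : nzRingType) (W : lmodType S).
Variables (iota : V -> W) (iotaD : {morph iota : x y / x + y}) (x : S).

Lemma vsubst_bound N (u : vpoly V) : (forall n, (N <= n)%N -> u n = 0) ->
  vsubst iota x u = \sum_(n < N) x ^+ n *: iota (u n).
Proof.
move=> u0; have iota0 : iota 0 = 0 by apply: (addrI (iota 0)); rewrite -iotaD !addr0.
rewrite (@vsubst_widen _ _ _ _ iotaD x (maxn N (vsize u))) ?leq_maxr //.
rewrite [RHS](big_ord_widen (maxn N (vsize u)) (fun n => x ^+ n *: iota (u n)));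
  last exact: leq_maxl.
rewrite [RHS]big_mkcond; apply: eq_bigr => n _; case: leqP => // hn.
by rewrite u0 // iota0 scaler0.
Qed.

End VsubstBound.

Lemma coef_XDXn (R : nzRingType) k n m :
  ((('X%:P + 'X) ^+ k : {poly {poly R}})`_n)`_m = ('C(k, n) * (k == m + n)%N)%:R.
Proof.
rewrite exprDn_comm; last exact: commr_polyX.
rewrite coef_sum coef_sum; case: (leqP n k) => nk; last first.
  rewrite bin_small // mul0n big1 // => i _.
  rewrite coefMn -polyC_exp coefCM coefXn; case: eqP => [e|_]; last first.
    by rewrite mulr0 mul0rn coef0.
  by have := ltn_ord i; rewrite -e ltnS leqNgt nk.
have nk' : (n < k.+1)%N by [].
rewrite (bigD1 (Ordinal nk')) //= big1 ?addr0 => [|i ne].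
  rewrite coefMn -polyC_exp coefCM coefXn eqxx mulr1 coefMn coefXn.
  by rewrite -(eqn_add2r n) subnK // eq_sym natrM mulr_natl.
rewrite coefMn -polyC_exp coefCM coefXn; case: eqP => [e|_]; last first.
  by rewrite mulr0 mul0rn coef0.
by move: ne; rewrite -val_eqE /= e eqxx.
Qed.

(** * Substitution of λ, μ and λ + μ, coefficient by coefficient *)

Section Vev.
Variables (R : nzRingType) (V : lmodType R).
Implicit Types u : vpoly V.

Let vvD : {morph (fun v : V => vconst (vconst v)) : x y / x + y}.
Proof. by move=> x y; rewrite !vconstD. Qed.

Lemma vevD (x : {poly {poly R}}) : {morph (@vev _ V x) : u v / u + v}.
Proof. exact: vsubstD. Qed.

(** The outer index n is the power of μ, the inner index m that of λ. The bound N is left free so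
    that it can be taken beyond any index of interest. *)
Lemma vev_coef (x : {poly {poly R}}) u N n m :
  (forall k, (N <= k)%N -> u k = 0) ->
  vev x u n m = \sum_(k < N) (x ^+ k)`_n`_m *: u k.
Proof.
move=> u0; rewrite /vev (vsubst_bound vvD x u0) !vcoef_sum.
by apply: eq_bigr => k _; rewrite !vcoefZvconst.
Qed.

Lemma vev_lambda u : vev 'X%:P u = vconst u.
Proof.
apply/vpolyP => n; apply/vpolyP => m; pose N := (vsize u + m.+1)%N.
have uN k : (N <= k)%N -> u k = 0.
  by move=> Nk; rewrite vsizeP // (leq_trans _ Nk) ?leq_addr.
have mN : (m < N)%N by rewrite /N addnS ltnS leq_addl.
rewrite (vev_coef _ _ _ uN) vconstE; case: n => [|n].
  rewrite (bigD1 (Ordinal mN)) //= -polyC_exp coefC coefXn eqxx scale1r.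
  rewrite big1 ?addr0 // => i im; rewrite -polyC_exp coefC coefXn.
  by rewrite -val_eqE /= eq_sym in im; rewrite (negPf im) scale0r.
by rewrite vcoef0 big1 // => i _; rewrite -polyC_exp coefC coef0 scale0r.
Qed.

Lemma vev_mu u n : vev 'X u n = vconst (u n).
Proof.
apply/vpolyP => m; pose N := (vsize u + n.+1)%N.
have uN k : (N <= k)%N -> u k = 0.
  by move=> Nk; rewrite vsizeP // (leq_trans _ Nk) ?leq_addr.
have nN : (n < N)%N by rewrite /N addnS ltnS leq_addl.
rewrite (vev_coef _ _ _ uN) (bigD1 (Ordinal nN)) //= big1 => [|i ni].
  rewrite coefXn eqxx coef1 addr0 vconstE.
  by case: m => *; rewrite ?scale1r ?scale0r.
rewrite coefXn; rewrite -val_eqE /= eq_sym in ni.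
by rewrite (negPf ni) coef0 scale0r.
Qed.

Lemma vev_lambda_mu u n m : vev ('X%:P + 'X) u n m = u (m + n)%N *+ 'C(m + n, n).
Proof.
pose N := (vsize u + (m + n).+1)%N.
have uN k : (N <= k)%N -> u k = 0.
  by move=> Nk; rewrite vsizeP // (leq_trans _ Nk) ?leq_addr.
have mN : (m + n < N)%N by rewrite /N addnS ltnS leq_addl.
rewrite (vev_coef _ _ _ uN) (bigD1 (Ordinal mN)) //= coef_XDXn eqxx muln1.
rewrite scaler_nat big1 ?addr0 // => i ni.
by rewrite -val_eqE /= in ni; rewrite coef_XDXn (negPf ni) muln0 scale0r.
Qed.

End Vev.

(** * Commutators of the coefficients of λ-actions *)

Section ConformalModule.
Variables (K : fieldType) (A : lieConformal K) (V : confModule A).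
Implicit Types (a b c : A) (u v : V) (p : {poly K}).

Lemma cm_actDr a : {morph @cm_act K A V a : u v / u + v}.
Proof.
by move=> u v; have := (cm_bilinear V).2 1 a u v; rewrite !polyC1 !scale1r.
Qed.
Lemma cm_actDl v : {morph (@cm_act K A V)^~ v : a b / a + b}.
Proof.
by move=> a b; have := (cm_bilinear V).1 1 a b v; rewrite !polyC1 !scale1r.
Qed.
Lemma cm_act0r a : cm_act a (0 : V) = 0.
Proof. by apply: (addrI (cm_act a (0 : V))); rewrite -cm_actDr !addr0. Qed.
Lemma cm_act0l v : cm_act (0 : A) v = 0.
Proof. by apply: (addrI (cm_act (0 : A) v)); rewrite -(cm_actDl v) !addr0. Qed.

Lemma cm_actZr a p v : cm_act a (p *: v) = at_dl p *: cm_act a v.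
Proof.
elim/poly_ind: p => [|p c IH].
  by rewrite scale0r cm_act0r /at_dl rmorph0 comp_poly0 scale0r.
rewrite addrC scalerDl (cm_bilinear V).2 mulrC -scalerA cm_dr IH scalerA.
by rewrite -scalerDl at_dlD at_dlC at_dlM at_dlX.
Qed.

Lemma cm_actZl a p v : cm_act (p *: a) v = at_ml p *: cm_act a v.
Proof.
elim/poly_ind: p => [|p c IH].
  by rewrite scale0r cm_act0l /at_ml rmorph0 comp_poly0 scale0r.
rewrite addrC scalerDl (cm_bilinear V).1 mulrC -scalerA cm_dl IH scalerA.
by rewrite -scalerDl at_mlD at_mlC at_mlM at_mlX.
Qed.

Lemma cm_act_coefX a v n : cm_act a ('X *: v) n =
  'X *: cm_act a v n + (if n is m.+1 then cm_act a v m else 0).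
Proof. by rewrite cm_dr scalerDl vcoefD vcoefZC vcoefZX. Qed.

(** Coefficient of λ^m μ^n in the Jacobi identity; on the left, exactly one term of each
    substitution contributes to it. *)
Lemma jacobi_coef a b v m n :
  cm_act a (cm_act b v n) m - cm_act b (cm_act a v m) n =
  vsubst (fun w : A => vev ('X%:P + 'X) (cm_act w v)) 'X%:P (lc_br a b) n m.
Proof.
rewrite -cm_jacobi vcoefD vcoefN vcoefD vcoefN; congr (_ - _).
  have D : {morph (fun w : V => vev 'X%:P (cm_act a w)) : x y / x + y}.
    by move=> x y /=; rewrite cm_actDr vevD.
  have [N bN] : exists N, (vsize (cm_act b v) <= N)%N /\ (n < N)%N.
    by exists (maxn (vsize (cm_act b v)) n.+1); rewrite leq_maxl leq_maxr.
  rewrite (vsubst_widen D _ bN.1) vcoef_sum vcoef_sum.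
  rewrite (bigD1 (Ordinal bN.2)) //= vcoefZXn leqnn subnn vev_lambda.
  rewrite vconstE big1 ?addr0 // => i ni.
  rewrite vcoefZXn vev_lambda; case: leqP; rewrite ?vcoef0 // => le_in.
  rewrite -val_eqE /= in ni; have lt_in : (i < n)%N by rewrite ltn_neqAle ni.
  by rewrite -(subnSK lt_in) vconstE vcoef0.
have D : {morph (fun w : V => vev 'X (cm_act b w)) : x y / x + y}.
  by move=> x y /=; rewrite cm_actDr vevD.
have [N bN] : exists N, (vsize (cm_act a v) <= N)%N /\ (m < N)%N.
  by exists (maxn (vsize (cm_act a v)) m.+1); rewrite leq_maxl leq_maxr.
rewrite (vsubst_widen D _ bN.1) vcoef_sum vcoef_sum.
rewrite (bigD1 (Ordinal bN.2)) //= -polyC_exp vcoefZC vcoefZXn leqnn subnn vev_mu.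
rewrite vconstE big1 ?addr0 // => i ni.
rewrite -polyC_exp vcoefZC vcoefZXn vev_mu; case: leqP => // le_im.
rewrite -val_eqE /= in ni; have lt_im : (i < m)%N by rewrite ltn_neqAle ni.
by rewrite -(subnSK lt_im) vconstE.
Qed.

Section Primary.
Variables (a b c : A).
Hypothesis ab : lc_br a b = ('X%:P + 'X *+ 2) *: vconst c.

(** As (∂c)_{λ+μ} = -(λ+μ) c_{λ+μ}, the right side of the Jacobi identity is -(λ+μ) c_{λ+μ} v + 2λ
    c_{λ+μ} v; the two summands are the coefficients of λ^m μ^n in these terms. *)
Let comm_coef v m n :
  cm_act a (cm_act b v n) m - cm_act b (cm_act a v m) n =
  (- 'X *: cm_act c v) (m + n)%N *+ 'C(m + n, n) +
  (if m is k.+1 then cm_act c v (k + n)%N *+ 'C(k + n, n) *+ 2 else 0).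
Proof.
have D : {morph (fun w : A => vev ('X%:P + 'X) (cm_act w v)) : x y / x + y}.
  by move=> x y /=; rewrite (cm_actDl v) vevD.
rewrite jacobi_coef ab (@vsubst_bound _ _ _ _ D _ 2); last first.
  move=> [|[|k]] // _; rewrite vcoefZvconst coefD coefC coefMn coefX /=.
  by rewrite mul0rn addr0 scale0r.
rewrite !big_ord_recl big_ord0 addr0 expr0 scale1r expr1 !vcoefZvconst.
rewrite coefD coefC coefMn coefX /= mul0rn addr0 cm_dl.
rewrite coefD coefC coefMn coefX /= add0r !vcoefD vev_lambda_mu; congr (_ + _).
rewrite scaler_nat mulr2n (D c c) /= vcoefZC vcoefZX; case: m => // k.
by rewrite !vcoefD !vev_lambda_mu mulr2n.
Qed.

Lemma comm_coef00 v : cm_act a (cm_act b v 0%N) 0%N = cm_act b (cm_act a v 0%N) 0%N.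
Proof.
apply/eqP; rewrite -subr_eq0 comm_coef scaleNr vcoefN vcoefZX.
by rewrite oppr0 mul0rn addr0.
Qed.

Lemma comm_coef0S v n : cm_act a (cm_act b v n.+1) 0%N =
  cm_act b (cm_act a v 0%N) n.+1 - cm_act c v n.
Proof.
apply/eqP; rewrite addrC -subr_eq; apply/eqP.
by rewrite comm_coef scaleNr vcoefN vcoefZX add0n binn addr0.
Qed.

Lemma comm_coefS v m n : cm_act a (cm_act b v n) m.+1 - cm_act b (cm_act a v m.+1) n =
  cm_act c v (m + n)%N *+ 'C(m + n, n) *+ 2 - cm_act c v (m + n)%N *+ 'C((m + n).+1, n).
Proof. by rewrite comm_coef scaleNr vcoefN vcoefZX addSn mulNrn addrC. Qed.

End Primary.

Lemma comm_coef_abelian a b v m n : lc_br a b = 0 ->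
  cm_act a (cm_act b v n) m = cm_act b (cm_act a v m) n.
Proof.
have D : {morph (fun w : A => vev ('X%:P + 'X) (cm_act w v)) : x y / x + y}.
  by move=> x y /=; rewrite (cm_actDl v) vevD.
move=> ab; apply/eqP; rewrite -subr_eq0 jacobi_coef ab.
by rewrite (@vsubst_bound _ _ _ _ D _ 0) ?big_ord0 ?vcoef0 // => k _; rewrite vcoef0.
Qed.

End ConformalModule.

Lemma vpoly_expand (R : nzRingType) (V : lmodType R) (u : vpoly V) :
  u = \sum_(k < vsize u) 'X^k *: vconst (u k).
Proof.
apply/vpolyP => n; rewrite vcoef_sum.
under eq_bigr do rewrite vcoefZvconst coefXn.
case: (ltnP n (vsize u)) => nu.
  rewrite (bigD1 (Ordinal nu)) //= eqxx scale1r big1 ?addr0 // => i.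
  by rewrite -val_eqE /= eq_sym => /negPf->; rewrite scale0r.
rewrite vsizeP // big1 // => i _.
by rewrite eqn_leq leqNgt (leq_trans (ltn_ord i) nu) scale0r.
Qed.

Section VsubstScale.
Variables (R : nzRingType) (V : lmodType R) (S : comNzRingType) (W : lmodType S).
Variables (iota : V -> W) (iotaD : {morph iota : x y / x + y}).
Variables (phi : {rmorphism R -> S}).
Hypothesis iotaZ : forall c v, iota (c *: v) = phi c *: iota v.
Variable x : S.

Lemma vsubstZ (P : {poly R}) (u : vpoly V) :
  vsubst iota x (P *: u) = (map_poly phi P).[x] *: vsubst iota x u.
Proof.
have s0 : vsubst iota x 0 = 0.
  by rewrite (vsubst_bound iotaD x (N := 0)) ?big_ord0 // => n _; rewrite vcoef0.
rewrite [in LHS](vpoly_expand u) scaler_sumr (big_morph _ (vsubstD iotaD x) s0).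
rewrite (vsubst_widen iotaD x (leqnn _)) scaler_sumr; apply: eq_bigr => k _.
rewrite !scalerA (vsubstZconst iotaD iotaZ) rmorphM rmorphXn /= map_polyX.
by rewrite hornerM hornerXn mulrC.
Qed.

End VsubstScale.

Section RestrictionOfScalars.
Variables (K : fieldType) (V : lmodType {poly K}).

(** A separate name lets V carry a K-vector space structure, through constant polynomials, beside
    its structure over K[∂]. *)
Definition scalars : Type := V.
HB.instance Definition _ := GRing.Zmodule.copy scalars V.

Let scaleK (c : K) (v : scalars) : scalars := c%:P *: (v : V).
Fact scaleKA a b v : scaleK a (scaleK b v) = scaleK (a * b) v.
Proof. by rewrite /scaleK scalerA polyCM. Qed.
Fact scaleK1 : left_id 1 scaleK.
Proof. by move=> v; rewrite /scaleK scale1r. Qed.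
Fact scaleKDr : right_distributive scaleK +%R.
Proof. by move=> a u v; exact: scalerDr. Qed.
Fact scaleKDl v : {morph scaleK^~ v : a b / a + b}.
Proof. by move=> a b; rewrite /scaleK polyCD scalerDl. Qed.
HB.instance Definition _ :=
  GRing.Zmodule_isLmodule.Build K scalars scaleKA scaleK1 scaleKDr scaleKDl.

Lemma scalarsE (c : K) (v : scalars) : c *: v = c%:P *: (v : V) :> V.
Proof. by []. Qed.

End RestrictionOfScalars.

Section CoefficientOperators.
Variables (K : fieldType) (A : lieConformal K) (V : confModule A).

Definition coef_op (a : A) (n : nat) (v : scalars V) : scalars V := cm_act a (v : V) n.

Lemma coef_op_linear a n : linear (coef_op a n).
Proof.
by move=> c u v; rewrite /coef_op scalarsE (cm_bilinear V).2 vcoefD vcoefZC.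
Qed.
HB.instance Definition _ a n := GRing.isLinear.Build _ _ _ _ (coef_op a n)
  (coef_op_linear a n).

(* Re-expanding [a_λ v] in powers of [x = ∂ + λ]; in this variable ∂ acts on v
   by multiplication by x, so that for fixed n the coefficients of x^n span a
   finite-dimensional space when v runs through the module. *)
Definition shifted_act (a : A) (v : V) : vpoly V :=
  vsubst (@vconst V) ('X - 'X%:P) (cm_act a v).

(** Substituting λ = x - ∂ turns p(∂ + λ) into p(x); here x is ['X] and ∂ is ['X%:P]. *)
Lemma shifted_actZ a (p : {poly K}) v :
  shifted_act a (p *: v) = map_poly polyC p *: shifted_act a v.
Proof.
rewrite /shifted_act cm_actZr (vsubstZ (@vconstD V) (@vconstZ _ V)); congr (_ *: _).
rewrite /at_dl map_comp_poly horner_comp rmorphD /= map_polyC map_polyX /=.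
rewrite hornerD hornerC hornerX addrC subrK; exact: comp_polyXr.
Qed.

(** (x - ∂)^n is monic of degree n in x, so among n <= N only n = N contributes to x^N, with factor
    1. *)
Lemma shifted_act_top a v N : (forall n, (N < n)%N -> cm_act a v n = 0) ->
  shifted_act a v N = cm_act a v N.
Proof.
move=> vN; rewrite /shifted_act (vsubst_bound (@vconstD V) _ vN).
rewrite vcoef_sum big_ord_recr /= big1 ?add0r => [|i _]; last first.
  rewrite vcoefZvconst nth_default ?scale0r //.
  by rewrite (leq_trans (size_poly_exp_leq _ _)) // size_XsubC mul1n.
rewrite vcoefZvconst; have := monic_exp N (monicXsubC ('X : {poly K})).
by rewrite monicE lead_coefE size_exp_XsubC => /eqP ->; rewrite scale1r.
Qed.

(** For v = Σ c_i g_i, the coefficient of x^N in Σ c_i(x) [shifted_act a g_i] involves the c_i only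
    up to degree N, and the r (N + 1) vectors that it combines do not depend on v. *)
Lemma coef_op_span a N : cm_finite V ->
  exists D (w : 'I_D -> scalars V), forall v : V,
    (forall n, (N < n)%N -> cm_act a v n = 0) ->
    exists c : 'rV[K]_D, coef_op a N v = lincomb w c.
Proof.
case=> r [g gen]; pose T : finType := ('I_r * 'I_N.+1)%type.
pose w (t : T) : scalars V := shifted_act a (g t.1) (N - t.2)%N.
exists #|T|, (fun k : 'I_#|T| => w (enum_val k)).
move=> v vN; have [c vE] := gen v.
pose e (t : T) : K := (c t.1)`_t.2; exists (\row_(k < #|T|) e (enum_val k)).
rewrite /coef_op -shifted_act_top // {1}vE.
have sD : {morph shifted_act a : x y / x + y}.
  by move=> x y; rewrite /shifted_act cm_actDr (vsubstD (@vconstD V)).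
have s0 : shifted_act a 0 = 0.
  by apply: (addrI (shifted_act a 0)); rewrite -sD !addr0.
rewrite (big_morph _ sD s0) vcoef_sum /lincomb.
transitivity (\sum_(t : T) e t *: w t).
  rewrite -(pair_bigA _ (fun i (j : 'I_N.+1) => e (i, j) *: w (i, j))) /=.
  apply: eq_bigr => i _; rewrite shifted_actZ vcoefZ; apply: eq_bigr => j _.
  by rewrite coef_map.
rewrite (reindex _ (onW_bij _ (@enum_val_bij T))); apply: eq_bigr => k _.
by rewrite mxE.
Qed.

End CoefficientOperators.

(** * Modules over the W(2,2) Lie conformal algebra *)

Lemma lead_coef_at_dl (K : fieldType) (p : {poly K}) :
  lead_coef (at_dl p) = (lead_coef p)%:P.
Proof.
rewrite /at_dl lead_coef_comp ?[_ + 'X]addrC ?size_XaddC //.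
rewrite lead_coefXaddC expr1n mulr1 lead_coef_map_inj //; exact: polyC_inj.
Qed.

(** The top power of λ carries an invertible scalar. This excludes torsion: p v = 0 gives p(∂ + λ)
    a_λ v = 0, and p(∂ + λ) has a scalar leading coefficient in λ. *)
Lemma vconst_torsion (K : fieldType) (V : lmodType {poly K})
    (P : {poly {poly K}}) (c : K) (v : V) :
  lead_coef P = c%:P -> c != 0 -> P *: vconst v = 0 -> v = 0.
Proof.
move=> lP c0 Pv; have := vcoefZvconst P v (size P).-1.
rewrite Pv vcoef0 -lead_coefE lP => /(f_equal ( *:%R c^-1%:P)).
by rewrite scaler0 scalerA -polyCM mulVf // scale1r.
Qed.

(** Serves both V and [modM Delta alpha], so that the isomorphism only has to compare
    coordinates. *)
Lemma cm_act_cyclic (K : fieldType) (V : confModule (w22 K)) (v : V) Q p x y :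
  cm_act (w22_L K : w22 K) v = Q *: vconst v ->
  cm_act (w22_H K : w22 K) v = 0 ->
  cm_act (x *: (w22_L K : w22 K) + y *: (w22_H K : w22 K)) (p *: v) =
  (at_ml x * at_dl p * Q) *: vconst v.
Proof.
move=> vL vH; rewrite (cm_actDl (p *: v)) !cm_actZl !cm_actZr vL vH.
by rewrite !scaler0 addr0 !scalerA.
Qed.

Section W22Modules.
Variables (K : closedFieldType) (V : confModule (w22 K)).

Local Notation W := (scalars V).
Local Notation eL := (w22_L K : w22 K).
Local Notation eH := (w22_H K : w22 K).
Local Notation l := (@coef_op K (w22 K) V eL).
Local Notation h := (@coef_op K (w22 K) V eH).

(** Shared by L and H, so that one computation gives the commutators of the l_m with both
    families. *)
Definition primary (a : w22 K) : Prop :=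
  lc_br eL a = ('X%:P + 'X *+ 2) *: vconst a.

Lemma primary_L : primary eL. Proof. exact: w22_LL. Qed.
Lemma primary_H : primary eH. Proof. exact: w22_LH. Qed.

(** The factor is 2 - (n + 1). In characteristic zero it vanishes only at n = 1, which is why that
    index is treated apart. *)
Lemma comm_l1 a n (v : W) : primary a ->
  l 1 (coef_op a n v) - coef_op a n (l 1 v) = (1 - n%:R) *: coef_op a n v.
Proof.
move=> pa; have /= := comm_coefS pa (v : V) 0 n.
rewrite add0n binn binSn => e.
have {}e : l 1 (coef_op a n v) - coef_op a n (l 1 v) =
  coef_op a n v *+ 1 *+ 2 - coef_op a n v *+ n.+1 by exact: e.
by rewrite e mulr1n scalerBl scale1r scaler_nat mulr2n mulrSr opprD addrCA addrK addrC.
Qed.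

(** Exhibits h_1 as a commutator, which [l_1, h_1] = 0 cannot do. *)
Lemma comm_l2_h0 (v : W) : l 2 (h 0 v) - h 0 (l 2 v) = h 1 v.
Proof.
have e : l 2 (h 0 v) - h 0 (l 2 v) = h 1 v *+ 1 *+ 2 - h 1 v *+ 1.
  exact: (comm_coefS primary_H (v : V) 1 0).
by rewrite e mulr1n mulr2n addrK.
Qed.

(** Stability arguments only use that the index m + n is at least n, so the scalar stays
    existential. *)
Lemma comm_lS a m n (v : W) : primary a -> exists c : K,
  l m.+1 (coef_op a n v) = coef_op a n (l m.+1 v) + c *: coef_op a (m + n) v.
Proof.
move=> pa; exists (2%:R * 'C(m + n, n)%:R - 'C((m + n).+1, n)%:R).
have e : l m.+1 (coef_op a n v) - coef_op a n (l m.+1 v) =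
  coef_op a (m + n) v *+ 'C(m + n, n) *+ 2 - coef_op a (m + n) v *+ 'C((m + n).+1, n).
  exact: (comm_coefS pa (v : V) m n).
by apply/eqP; rewrite addrC -subr_eq e scalerBl -scalerA !scaler_nat.
Qed.

Lemma comm_l0 a n (v : W) : primary a -> l 0 (coef_op a n v) =
  coef_op a n (l 0 v) - (if n is m.+1 then coef_op a m v else 0).
Proof.
move=> pa; case: n => [|n]; first by rewrite subr0; exact: (comm_coef00 pa).
exact: (comm_coef0S pa).
Qed.

Lemma comm_h m n (v : W) : h m (h n v) = h n (h m v).
Proof. exact/comm_coef_abelian/w22_HH. Qed.

Lemma w22_act_eq0 (v : V) : cm_act eL v = 0 -> cm_act eH v = 0 ->
  forall a : w22 K, cm_act a v = 0.
Proof.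
move=> vL vH a; have [[p q] [/= -> _]] := w22_basis a.
by rewrite (cm_actDl v) !cm_actZl vL vH !scaler0 addr0.
Qed.

Lemma w22_submodule (U : V -> Prop) : U 0 ->
  (forall u v, U u -> U v -> U (u + v)) ->
  (forall (c : {poly K}) u, U u -> U (c *: u)) ->
  (forall u n, U u -> U (cm_act eL u n)) ->
  (forall u n, U u -> U (cm_act eH u n)) -> cm_submodule U.
Proof.
move=> U0 UD UZ UL UH; split=> // a u n Uu.
have [[p q] [/= -> _]] := w22_basis a.
rewrite (cm_actDl u) vcoefD !cm_actZl !vcoefZ.
by apply: (UD); apply: (big_ind U U0 UD) => i _; apply: UZ; [exact: UL|exact: UH].
Qed.

(* ∂ and l_0 have the same commutators with the l_n and h_n, so ∂ - l_0 commutes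
   with the whole action. *)
Definition dersub (v : W) : W := ('X *: (v : V)) - l 0 v.

(** Setting λ = 0 in p(∂ + λ) leaves p(∂). *)
Lemma coef0_actZ (a : w22 K) (p : {poly K}) (v : V) :
  cm_act a (p *: v) 0%N = p *: cm_act a v 0%N.
Proof.
rewrite cm_actZr vcoefZ big_ord_recl big_ord0 addr0 /= subn0; congr (_ *: _).
rewrite -horner_coef0 /at_dl horner_comp hornerD hornerC hornerX addr0.
exact: comp_polyXr.
Qed.

Lemma dersubZ (p : {poly K}) (v : V) : dersub (p *: v) = p *: (dersub v : V).
Proof.
by rewrite /dersub /coef_op coef0_actZ scalerBr scalerA mulrC -scalerA.
Qed.

Lemma dersub_linear : linear dersub.
Proof.
move=> c u v; rewrite [dersub v]/dersub.
have e : dersub (c *: u) = c *: dersub u by exact: dersubZ.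
rewrite -e /dersub (linearD (l 0)) opprD addrACA; congr (_ + _).
exact: (scalerDr 'X (c%:P *: (u : V))).
Qed.
HB.instance Definition _ := GRing.isLinear.Build _ _ _ _ dersub dersub_linear.

Lemma dersub_comm a n (v : W) : primary a ->
  dersub (coef_op a n v) = coef_op a n (dersub v).
Proof.
move=> pa; rewrite /dersub (linearB (coef_op a n)) /= comm_l0 // opprB addrA.
congr (_ - _).
by apply/esym; exact: cm_act_coefX.
Qed.

(** Two thresholds, because stability under the h_m is obtained for M = N + 1, and because the
    dimension bound lowers them one at a time. *)
Definition killed M N (v : W) : Prop :=
  (forall n, (M <= n)%N -> l n v = 0) /\ (forall n, (N <= n)%N -> h n v = 0).

Lemma killed_subspace M N : subspace (killed M N).
Proof.
split=> [|c u v [ul uh] [vl vh]]; first by split=> n _; exact: linear0.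
by split=> n nM; rewrite linearP /= ?ul ?uh ?vl ?vh // scaler0 addr0.
Qed.

Lemma killed_exists (v : W) : exists N, killed N N v.
Proof.
exists (vsize (cm_act eL (v : V)) + vsize (cm_act eH (v : V)))%N.
by split=> n nM; apply: vsizeP; apply: leq_trans nM; rewrite ?leq_addr ?leq_addl.
Qed.

Lemma killed_dersub M N : stable (killed M N) dersub.
Proof.
move=> v [vl vh]; split=> n nM.
  by rewrite -(dersub_comm _ _ primary_L) vl // linear0.
by rewrite -(dersub_comm _ _ primary_H) vh // linear0.
Qed.

Lemma killed_lS N m : stable (killed N.+1 N) (l m.+1).
Proof.
move=> v [vl vh]; split=> n nN;
  have nN' : (_ <= m + n)%N := leq_trans nN (leq_addl m n).
  have [c] := comm_lS m n v primary_L.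
  by rewrite (vl n nN) (vl _ nN') linear0 scaler0 addr0 => <-.
have [c] := comm_lS m n v primary_H.
by rewrite (vh n nN) (vh _ nN') linear0 scaler0 addr0 => <-.
Qed.

(** For n > N, [l_n, h_m] is a multiple of h_{n-1+m}, whose index is at least N: hence the offset
    between the thresholds. *)
Lemma killed_h N m : stable (killed N.+1 N) (h m).
Proof.
move=> v [vl vh]; split=> n nN; last by rewrite comm_h (vh n nN) linear0.
case: n nN => // n nN; have [c ->] := comm_lS n m v primary_H.
rewrite (vl _ nN) linear0 add0r (vh (n + m)) ?scaler0 //.
exact: leq_trans nN (leq_addr _ _).
Qed.

(** * Irreducible modules: vanishing of H and the form of L *)

Section Irreducible.
Hypotheses (fin : cm_finite V) (irr : cm_irreducible V) (nt : ~ cm_trivial V).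

Lemma submodule_full (U : V -> Prop) u :
  cm_submodule U -> U u -> u <> 0 -> forall v, U v.
Proof. by move=> /irr.2[U0|//] Uu nu; case: nu; exact: U0. Qed.

(** The vectors killed by the whole algebra form a submodule; were it nonzero, the action would be
    trivial. *)
Lemma faithful (v : V) : cm_act eL v = 0 -> cm_act eH v = 0 -> v = 0.
Proof.
move=> vL vH; apply: contrapT => nv; apply: nt => a u; move: u a.
apply: (@submodule_full _ v) => //; last exact: w22_act_eq0.
apply: w22_submodule => [a|x y ex ey a|p x ex a|x n ex a|x n ex a].
- exact: cm_act0r.
- by rewrite cm_actDr ex ey addr0.
- by rewrite cm_actZr ex scaler0.
- by rewrite ex vcoef0 cm_act0r.
- by rewrite ex vcoef0 cm_act0r.
Qed.

(** Lowering a threshold by one means passing to the kernel of l_M or h_N, whose image is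
    finite-dimensional by [coef_op_span]; at thresholds 0 only the zero vector remains, by
    [faithful]. *)
Lemma killed_fdim M N : fdim (killed M N).
Proof.
elim: M => [|M IH].
  elim: N => [|N IH].
    apply: fdim0 => v [vl vh]; apply: faithful; apply: vpoly_eq0 => n.
      exact: vl.
    exact: vh.
  have [D [w gen]] := coef_op_span eH N fin.
  apply: (@fdim_ker _ _ _ (h N) D w) => [|u [_ uh]|].
  - exact: killed_subspace.
  - by apply: gen => n nN; exact: uh.
  - apply: fdim_sub IH => u [[ul uh] uN]; split=> // n.
    by rewrite leq_eqVlt => /predU1P[<-|]; [exact: uN|exact: uh].
have [D [w gen]] := coef_op_span eL M fin.
apply: (@fdim_ker _ _ _ (l M) D w) => [|u [ul _]|].
- exact: killed_subspace.
- by apply: gen => n nN; exact: ul.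
- apply: fdim_sub IH => u [[ul uh] uN]; split=> // n.
  by rewrite leq_eqVlt => /predU1P[<-|]; [exact: uN|exact: ul].
Qed.

Hypothesis char0 : [pchar K] =i pred0.

Lemma nat_neq1 n : n != 1 -> 1 - n%:R != 0 :> K.
Proof.
have cN0 := (pcharf0P K).1 char0; case: n => [|n] n1; first by rewrite subr0 oner_neq0.
by rewrite mulrS opprD addrA subrr sub0r oppr_eq0 cN0.
Qed.

(* Each h_n is singular by [comm_singular]: h_1 because [l_2, h_0] = h_1, and then,
   on the kernels obtained so far, h_n because [l_1, h_n] = (1 - n) h_n. *)
Lemma H_kernel : exists2 u : W, u <> 0 & forall n, h n u = 0.
Proof.
have [v nv] := irr.1; have [N kN] := killed_exists (v : W).
pose U := killed N.+1 N; have Uv : U v.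
  by split=> n nN; [apply: kN.1; exact: ltnW|exact: kN.2].
have sU : subspace U by exact: killed_subspace.
have fU : fdim U by exact: killed_fdim.
(* The condition on h_1 is imposed from the start, since the factor 1 - n is zero at n = 1. *)
pose Uk k (u : W) := [/\ U u, h 1 u = 0 & forall n, (n < k)%N -> h n u = 0].
suff /(_ N)[u nu [Uu _ uN]] : forall k, exists2 u : W, u <> 0 & Uk k u.
  by exists u => // n; case: (ltnP n N) => [/uN|/Uu.2].
elim=> [|k [u nu Uku]].
  have [||u [Uu u1] nu] := @comm_singular _ _ U (l 2) (h 0) (h 1) 1 v char0
    (oner_neq0 _) sU fU Uv nv (@killed_lS N 1) (@killed_h N 0) (@killed_h N 1).
  - by move=> u _; rewrite scale1r comm_l2_h0.
  - by move=> u _; exact: comm_h.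
  - by exists u.
have [k1|k1] := eqVneq k 1.
  case: Uku => Uu u1 uk; exists u => //; split=> // n.
  by rewrite ltnS leq_eqVlt k1 => /predU1P[->//|]; rewrite -k1; exact: uk.
have sUk : subspace (Uk k).
  split=> [|c x y [Ux x1 xk] [Uy y1 yk]].
    by split=> [||n _]; rewrite ?linear0 //; exact: sU.1.
  split=> [||n nk]; first exact: sU.2.
    by rewrite linearP /= x1 y1 scaler0 addr0.
  by rewrite linearP /= xk // yk // scaler0 addr0.
have fUk : fdim (Uk k) by apply: fdim_sub fU => x [].
(* [l_1, h_n] is a multiple of h_n, so l_1 preserves the kernel of h_n. *)
have h_l1 n (x : W) : h n x = 0 -> h n (l 1 x) = 0.
  move=> xn; apply/eqP; rewrite -oppr_eq0; apply/eqP.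
  by have := comm_l1 n x primary_H; rewrite xn linear0 scaler0 sub0r.
have Uk_h : stable (Uk k) (h k).
  move=> x [Ux x1 xk]; split=> [||n nk]; first exact: killed_h.
    by rewrite comm_h x1 linear0.
  by rewrite comm_h xk // linear0.
have Uk_l1 : stable (Uk k) (l 1).
  move=> x [Ux x1 xk]; split=> [||n nk]; [exact: killed_lS|exact: h_l1|].
  exact/h_l1/xk.
have [|//|x [[Ux x1 xk] xk'] nx] := @comm_singular _ _ (Uk k) (l 1) (h k) (h k) _ u
    char0 (nat_neq1 k1) sUk fUk Uku nu Uk_l1 Uk_h Uk_h.
  by move=> x _; exact: comm_l1 primary_H.
exists x => //; split=> // n.
by rewrite ltnS leq_eqVlt => /predU1P[->|/xk].
Qed.

(** The common kernel of the h_n is a submodule, since each [l_m, h_n] is a multiple of some h_k; it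
    is nonzero by [H_kernel]. *)
Lemma H_acts_trivially (v : V) : cm_act eH v = 0.
Proof.
have [u nu uh] := H_kernel; move: v.
apply: (@submodule_full _ (u : V)) => //; last by apply: vpoly_eq0 => n; exact: uh.
apply: w22_submodule => [|x y ex ey|p x ex|x n ex|x n ex].
- exact: cm_act0r.
- by rewrite cm_actDr ex ey addr0.
- by rewrite cm_actZr ex scaler0.
- have hx k : h k (x : W) = 0 by rewrite /coef_op ex vcoef0.
  apply: vpoly_eq0 => k; apply: (_ : h k (l n (x : W)) = 0).
  case: n => [|n].
    have := comm_l0 k (x : W) primary_H; rewrite hx linear0 => /eqP.
    rewrite eq_sym subr_eq0 => /eqP ->.
    by case: k => // k; exact: hx.
  by have [c] := comm_lS n k (x : W) primary_H; rewrite !hx linear0 scaler0 addr0.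
- by rewrite ex vcoef0 cm_act0r.
Qed.

(** Schur's argument: ∂ - l_0 has an eigenvector in a finite-dimensional killed space, and its
    eigenspace is a submodule because it commutes with ∂ and with the action. *)
Lemma dersub_scalar : exists a : K, forall v : V, cm_act eL v 0%N = ('X + a%:P) *: v.
Proof.
have [v nv] := irr.1; have [N kN] := killed_exists (v : W).
have [a [u [_ nu ua]]] := eigenvector_on (@killed_subspace N N)
  (killed_fdim N N) kN nv (@killed_dersub N N).
exists (- a) => w; suff ew : dersub (w : W) = a *: (w : W).
  by rewrite polyCN scalerBl -scalarsE -ew /dersub opprB addrC subrK.
move: w; apply: (@submodule_full _ (u : V)) => //.
apply: w22_submodule => [|x y ex ey|p x ex|x n ex|x n ex].
- by rewrite linear0 scaler0.
- by rewrite [LHS]linearD /= ex ey -scalerDr.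
- by rewrite dersubZ ex !scalarsE !scalerA mulrC.
- have -> : cm_act eL x n = l n (x : W) by [].
  by rewrite (dersub_comm _ _ primary_L) ex linearZ.
- by rewrite H_acts_trivially vcoef0 linear0 scaler0.
Qed.

(** For n > 1, l_n is singular on the vectors killed by all later coefficients, so the threshold
    descends to 2. There l_1 still acts, on a finite-dimensional space, and has an eigenvector. *)
Lemma L_eigenvector : exists (a : K) (u : W),
  [/\ u <> 0, l 1 u = a *: u & forall n, (1 < n)%N -> l n u = 0].
Proof.
pose U M (u : W) := forall n, (M <= n)%N -> l n u = 0.
have U_killed M u : U M u -> killed M 0 u.
  by move=> Uu; split=> // n _; rewrite /coef_op H_acts_trivially vcoef0.
have sU M : subspace (U M).
  split=> [n _|c u v Uu Uv n nM]; first exact: linear0.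
  by rewrite linearP /= Uu // Uv // scaler0 addr0.
have fU M : fdim (U M) by apply: fdim_sub (killed_fdim M 0) => u /U_killed.
have U_l M m : stable (U M) (l m.+1).
  move=> u Uu n nM; have [c] := comm_lS m n u primary_L.
  rewrite (Uu n nM) (Uu (m + n)); last exact: leq_trans nM (leq_addl _ _).
  by rewrite linear0 scaler0 addr0 => <-.
suff [u nu Uu] : exists2 u : W, u <> 0 & U 2 u.
  have [a [x [Ux nx xa]]] := eigenvector_on (sU 2) (fU 2) Uu nu (@U_l 2 0).
  by exists a, x.
have [v nv] := irr.1; have [N [vl _]] := killed_exists (v : W).
(* Weakened from N to N + 2 so that the induction on N ends at [U 2]. *)
have : U N.+2 (v : W) by move=> n nN; apply: vl; do 2!apply: ltnW.
elim: N v nv {vl} => [|N IH] v nv Uv; first by exists (v : W).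
have [|//|u [Uu uN] nu] := @comm_singular _ _ (U N.+3) (l 1) (l N.+2) (l N.+2) _
    (v : W) char0 (@nat_neq1 N.+2 isT) (sU _) (fU _) Uv nv
    (@U_l _ 0) (@U_l _ N.+1) (@U_l _ N.+1).
  by move=> x _; exact: comm_l1 primary_L.
apply: (IH u) => // n; rewrite leq_eqVlt => /predU1P[<-//|]; exact: Uu.
Qed.

Lemma L_generator : exists (Delta alpha : K) (v : V), v <> 0 /\
  cm_act eL v = ('X%:P + alpha%:P%:P + Delta%:P%:P * 'X) *: vconst v.
Proof.
have [Delta [v [nv v1 v2]]] := L_eigenvector; have [alpha v0] := dersub_scalar.
exists Delta, alpha, v; split=> //; apply/vpolyP => n.
rewrite vcoefZvconst !coefD coefCM !coefC coefX.
case: n => [|[|n]] /=.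
- by rewrite mulr0 addr0 v0.
- by rewrite mulr1 !add0r; exact: v1.
- by rewrite mulr0 !addr0 scale0r; exact: v2.
Qed.

(** L_λ(p u) = p(∂ + λ) P u has its coefficients in K[∂]u and H acts by zero, so K[∂]u is a nonzero
    submodule. *)
Lemma cyclic_full (u : V) P : cm_act eL u = P *: vconst u -> u <> 0 ->
  forall w : V, exists p : {poly K}, w = p *: u.
Proof.
move=> uL nu; apply: (@submodule_full _ u) => //; last by exists 1; rewrite scale1r.
apply: w22_submodule => [|x y [p ->] [q ->]|c x [p ->]|x n [p ->]|x n _].
- by exists 0; rewrite scale0r.
- by exists (p + q); rewrite scalerDl.
- by exists (c * p); rewrite scalerA.
- by exists (at_dl p * P)`_n; rewrite cm_actZr uL scalerA vcoefZvconst.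
- by exists 0; rewrite H_acts_trivially vcoef0 scale0r.
Qed.

(** * The free generator and the isomorphism with M_{Δ,α} *)

Section Generator.
Variables (Delta alpha : K) (v : V).
Hypothesis v_neq0 : v <> 0.
Hypothesis vL : cm_act eL v =
  ('X%:P + alpha%:P%:P + Delta%:P%:P * 'X) *: vconst v.

(* If Δ = 0 then (∂ + α)v generates a submodule; that it contains v forces
   torsion, on which λ-actions vanish. *)
Lemma Delta_neq0 : Delta != 0.
Proof.
apply/eqP => D0; pose u : V := ('X + alpha%:P) *: v.
have vu : cm_act eL v = vconst u.
  by rewrite vL D0 !polyC0 mul0r addr0 vconstZ polyCD.
(* L_λ v = u is free of λ, so L_λ u = (∂ + λ + α) L_λ v = (∂ + λ + α) u. *)
have uL : cm_act eL u = ('X%:P + 'X + alpha%:P%:P) *: vconst u.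
  by rewrite cm_actZr vu at_dlD at_dlX at_dlC.
have nu : u <> 0.
  by move=> u0; apply/v_neq0/faithful; rewrite ?H_acts_trivially // vu u0 vconst0.
have [q vq] := cyclic_full uL nu v.
(* This p kills v and takes the value 1 at -α, so it is nonzero. *)
pose p := 1 - q * ('X + alpha%:P).
have pv : p *: v = 0 by rewrite scalerBl scale1r -scalerA -vq subrr.
have p0 : lead_coef p != 0.
  rewrite lead_coef_eq0; apply/eqP => /(f_equal (horner^~ (- alpha))).
  rewrite hornerD hornerN hornerM hornerD hornerX !hornerC addNr mulr0 subr0.
  exact/eqP/oner_neq0.
(* From p v = 0 follows p(∂ + λ) u = L_λ(p v) = 0, which forces u = 0. *)
apply/nu/(vconst_torsion (lead_coef_at_dl p) p0).
by rewrite -vu -cm_actZr pv cm_act0r.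
Qed.

(** If p v = 0, then p(∂ + λ)(∂ + α + Δλ) v = L_λ(p v) = 0. For p nonzero the leading coefficient in
    λ is a nonzero scalar, as Δ is nonzero, and v would vanish. *)
Lemma generator_free (p : {poly K}) : p *: v = 0 -> p = 0.
Proof.
move=> pv; apply/eqP; apply/negPn/negP => p0; apply: v_neq0.
have lQ : lead_coef ('X%:P + alpha%:P%:P + Delta%:P%:P * 'X) = Delta%:P.
  rewrite -polyCD addrC mul_polyC lead_coefDl ?lead_coefZ ?lead_coefX ?mulr1 //.
  by rewrite size_scale ?polyC_eq0 ?Delta_neq0 // size_polyX ltnS size_polyC_leq1.
apply: (@vconst_torsion _ _ (at_dl p * ('X%:P + alpha%:P%:P + Delta%:P%:P * 'X))
  (lead_coef p * Delta)).
- by rewrite lead_coefM lQ lead_coef_at_dl polyCM.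
- by rewrite mulf_neq0 ?lead_coef_eq0 ?Delta_neq0.
- by rewrite -scalerA -vL -cm_actZr pv cm_act0r.
Qed.

Lemma isomorphic_modM : cm_isomorphic V (modM Delta alpha).
Proof.
(* Stated with [==] so that [xchoose] applies; the resulting f is the inverse of the map sending p
   to p v. *)
have gen w : exists p : {poly K}, p *: v == w.
  by have [p ->] := cyclic_full vL v_neq0 w; exists p.
pose f (w : V) : modM Delta alpha := xchoose (gen w).
have fK w : (f w : {poly K}) *: v = w by apply/eqP/(xchooseP (gen w)).
have inj (p q : {poly K}) : p *: v = q *: v -> p = q.
  move=> e; apply/eqP; rewrite -subr_eq0; apply/eqP/generator_free.
  by rewrite scalerBl e subrr.
have Kf (p : {poly K}) : f (p *: v) = p by apply: inj; rewrite fK.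
have f_lin : linear f.
  move=> c x y; apply: inj; rewrite fK.
  by rewrite [RHS]scalerDl -[in RHS]scalerA !fK.
pose F : {linear V -> modM Delta alpha} :=
  HB.pack f (GRing.isLinear.Build _ _ _ _ f f_lin).
exists F; split.
  by exists (fun p : {poly K} => p *: v).
move=> a w n; have [[x y] [-> _]] := w22_basis a.
have Fw : F w = (f w : {poly K}) *: (modM_v K : modM Delta alpha).
  by rewrite [RHS]mulr1.
rewrite Fw (cm_act_cyclic _ _ _ (modM_L _ _) (modM_H _ _)) vcoefZvconst.
rewrite -[in RHS](fK w) (cm_act_cyclic _ _ _ vL (H_acts_trivially v)) vcoefZvconst.
by apply: etrans (esym (Kf _)); rewrite [LHS]mulr1.
Qed.

End Generator.

End Irreducible.
End W22Modules.

Theorem corollary3p9 (R : realType) (V : confModule (w22 R[i])) :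
  cm_finite V -> cm_irreducible V -> ~ cm_trivial V ->
  exists Delta alpha : R[i], Delta != 0 /\ cm_isomorphic V (modM Delta alpha).
Proof.
move=> fin irr nt; have char0 : [pchar R[i]] =i pred0 by exact: Num.Theory.pchar_num.
have [Delta [alpha [v [nv vL]]]] := L_generator fin irr nt char0.
exists Delta, alpha; split; first exact: (Delta_neq0 fin irr nt char0 nv vL).
exact: (isomorphic_modM fin irr nt char0 nv vL).
Qed.
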